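(* Let $n\ge 1$ and $L\ge 1$ be integers, let $\mathbb{R}_+=[0,\infty)$, and let $F=(f_1,\ldots,f_L):\mathbb{R}_+^L\to\mathbb{R}_+^L$ be continuous on $\mathbb{R}_+^L$ and locally Lipschitz in the interior of $\mathbb{R}_+^L$. Assume that $F$ is non-degenerate. Assume also that for every $R>0$ the Dirichlet problem $$-\Delta u_i=f_i(u)\ \text{ in } B_R,\qquad u_i>0\ \text{ in } B_R,\qquad u_i=0\ \text{ on }\partial B_R,\qquad i=1,\ldots,L,$$ where $B_R=\{x\in\mathbb{R}^n: |x|<R\}$, admits no solution. Then the system $$-\Delta u_i=f_i(u)\ \text{ in }\mathbb{R}^n,\qquad u_i>0\ \text{ in }\mathbb{R}^n,\qquad i=1,\ldots,L,$$ admits a solution $u=(u_1,\ldots,u_L)$. Furthermore, if in addition $F(u)\neq 0$ for every $u\in\mathbb{R}_+^L$ with $u>0$, then this system on $\mathbb{R}^n$ admits a solution $u(x)$ such that $u(x)\to 0$ uniformly as $|x|\to\infty$.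
   Context: For $u\in\mathbb{R}^L$, $u>0$ means that all components are positive: $u_i>0$ for $i=1,\ldots,L$. Non-degenerate (also called non-reducible): $F=(f_1,\ldots,f_L)$ is non-degenerate if for any permutation $i_1,\ldots,i_L$ of $1,\ldots,L$, any $1\le k<L$, and any $u\in\mathbb{R}_+^L$ with $u_{i_1}>0,\ldots,u_{i_k}>0$ and $u_{i_{k+1}}=\cdots=u_{i_L}=0$, one has $f_{i_{k+1}}(u)+\cdots+f_{i_L}(u)>0$. Solutions are understood in the classical sense: $u_i\in C^2(\mathbb{R}^n)$ for the system on $\mathbb{R}^n$, and $u_i\in C^2(B_R)\cap C(\overline{B_R})$ for the Dirichlet problem on $B_R$. *)

(* Defs.v *)
From mathcomp Require Import all_boot all_order all_algebra all_fingroup.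
From mathcomp Require Import all_classical all_reals all_analysis.

Set Implicit Arguments.
Unset Strict Implicit.
Unset Printing Implicit Defensive.

Import Order.TTheory GRing.Theory Num.Theory.
Import numFieldNormedType.Exports.

Local Open Scope classical_set_scope.
Local Open Scope ring_scope.

(* The library norm on row vectors is the sup norm, so the Euclidean norm
   needed for [B_R] and for [|x| -> oo] is defined here. *)
Definition enorm {R : realType} {n : nat} (x : 'rV[R]_n) : R :=
  Num.sqrt (\sum_(i < n) x ord0 i ^+ 2).

Definition eball {R : realType} (n : nat) (r : R) : set 'rV[R]_n :=
  [set x | enorm x < r].

Arguments eball {R} n r _.

Definition boundary {T : topologicalType} (A : set T) : set T :=
  closure A `\` A°.

Definition pderive {R : realType} {n : nat} (i : 'I_n) (f : 'rV[R]_n -> R) :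
    'rV[R]_n -> R :=
  'D_(delta_mx ord0 i) f.

Definition laplacian {R : realType} {n : nat} (f : 'rV[R]_n -> R) :
    'rV[R]_n -> R :=
  fun x => \sum_(i < n) pderive i (pderive i f) x.

(* [C_k k U f]: [f] is of class [C^k] on [U]; meant for open [U] only, where
   continuity and derivatives at points of [U] ignore the values off [U]. *)
Fixpoint C_k {R : realType} {n : nat} (k : nat) (U : set 'rV[R]_n)
    (f : 'rV[R]_n -> R) : Prop :=
  (forall x, U x -> {for x, continuous f}) /\
  (if k is k'.+1 then
     forall i : 'I_n,
       (forall x, U x -> derivable f x (delta_mx ord0 i)) /\
       C_k k' U (pderive i f)
   else True).

Definition orthant {R : realType} (L : nat) : set 'rV[R]_L :=
  [set u | forall i, 0 <= u ord0 i].

Arguments orthant {R} L _.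

Definition pos_vec {R : realType} {L : nat} (u : 'rV[R]_L) : Prop :=
  forall i, 0 < u ord0 i.

(* The permutation [i_1, ..., i_L] is [s 0, ..., s (L - 1)]. *)
Definition nondegenerate_map {R : realType} {L : nat}
    (F : 'rV[R]_L -> 'rV[R]_L) : Prop :=
  forall (s : 'S_L) (k : nat), (1 <= k < L)%N ->
  forall u : 'rV[R]_L, orthant L u ->
    (forall j : 'I_L, (j < k)%N -> 0 < u ord0 (s j)) ->
    (forall j : 'I_L, (k <= j)%N -> u ord0 (s j) = 0) ->
  0 < \sum_(j < L | (k <= j)%N) F u ord0 (s j).

Definition positive_solution {R : realType} {n L : nat}
    (F : 'rV[R]_L -> 'rV[R]_L) (U : set 'rV[R]_n)
    (u : 'rV[R]_n -> 'rV[R]_L) : Prop :=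
  (forall i : 'I_L, C_k 2 U (fun x => u x ord0 i)) /\
  (forall x, U x -> forall i : 'I_L,
     - laplacian (fun y => u y ord0 i) x = F (u x) ord0 i) /\
  (forall x, U x -> pos_vec (u x)).

(* [u] is a total function, but only its values on the closed ball matter. *)
Definition dirichlet_solution {R : realType} {n L : nat}
    (F : 'rV[R]_L -> 'rV[R]_L) (r : R) (u : 'rV[R]_n -> 'rV[R]_L) : Prop :=
  positive_solution F (eball n r) u /\
  {within closure (eball n r), continuous u} /\
  (forall x, boundary (eball n r) x -> u x = 0).

Definition vanishes_at_infinity {R : realType} {n L : nat}
    (u : 'rV[R]_n -> 'rV[R]_L) : Prop :=
  forall e : R, 0 < e ->
    exists r : R, forall x : 'rV[R]_n, r < enorm x -> `|u x| < e.

(* Main.v *)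
(* Shoot from initial data [a] in the unit simplex with radial profiles, whose
   components are nonincreasing because the source is nonnegative. For a
   discretised equation the orbit depends continuously on [a], so the sets
   [A i] of data for which component [i] is the one to reach zero first are
   closed, contain the faces [a_i = 0], and cover the simplex unless some orbit
   stays positive. By the dual form of the Knaster-Kuratowski-Mazurkiewicz
   theorem, which follows from Scarf's lemma, they have a common point, whose
   orbit reaches the origin. In the limit of vanishing mesh one gets a
   nonnegative profile that either reaches the origin at a finite radius or is
   global; nondegeneracy makes its components vanish simultaneously, so the
   first case is a solution of the Dirichlet problem on a ball. A limit at
   infinity of a global profile must be a zero of [F]. *)

(* [F] is merely continuous up to the boundary of the orthant, so the radial equation may have
   several solutions with the same data and no continuous dependence on them; each fixed mesh
   restores it. The iterates can overshoot the orthant by one step, so [F] is replaced by the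
   bounded continuous map [F (clip u)]; profiles start in the simplex and are nonincreasing, so
   clipping is not felt while they are nonnegative. In the variable [s = |x|^2] a radial function is
   of class C^2 at the origin as soon as [g] extends continuously to [s = 0], where
   [2 s g' = - (B p + n g)] forces [g 0 = - B (p 0) / n]. The time horizon grows while the mesh
   shrinks, so one limit covers both alternatives: the stopping times are bounded along the
   ultrafilter, or they are not. One and the same profile serves both conclusions of the theorem. *)
Require Import Defs.
From mathcomp Require Import all_boot all_order all_algebra all_fingroup.

Set Implicit Arguments.
Unset Strict Implicit.
Unset Printing Implicit Defensive.

(** * Scarf's lemma *)

Section Scarf.
Local Open Scope nat_scope.
Variables (X I : finType) (c : X -> I) (pos : I -> X -> nat).
Hypothesis pos_inj : forall i, injective (pos i).

(** For nonempty [Y]: no point lies strictly above the lowest member of [Y] in all rankings of [C]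
    at once. On a grid this says, up to ties, that the corner cut out by the minima of [Y] has no
    grid point in its interior. *)
Definition dominant (Y : {set X}) (C : {set I}) : bool :=
  [forall x, [exists i in C, [forall y in Y, pos i x <= pos i y]]].

Lemma dominantP (Y : {set X}) (C : {set I}) :
  reflect (forall x, exists2 i, i \in C & forall y, y \in Y -> pos i x <= pos i y)
    (dominant Y C).
Proof.
apply: (iffP forallP) => H x.
  have /existsP[i /andP[iC /forallP h]] := H x; exists i => // y yY.
  by have := h y; rewrite yY.
have [i iC h] := H x; apply/existsP; exists i; rewrite iC /=.
by apply/forallP => y; apply/implyP => /h.
Qed.

Lemma dominantS (Y Y' : {set X}) (C C' : {set I}) :
  Y' \subset Y -> C \subset C' -> dominant Y C -> dominant Y' C'.
Proof.
move=> sY sC /dominantP H; apply/dominantP => x; have [i iC h] := H x.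
by exists i => [|y yY]; [exact: (subsetP sC) | apply: h; exact: (subsetP sY)].
Qed.

Lemma dominantPn (Y : {set X}) (C : {set I}) :
  ~~ dominant Y C ->
  exists x, forall i, i \in C -> exists2 y, y \in Y & pos i y < pos i x.
Proof.
rewrite negb_forall => /existsP[x]; rewrite negb_exists => /forallP h.
exists x => i iC; have := h i; rewrite iC /= negb_forall => /existsP[y].
by rewrite negb_imply -ltnNge => /andP[yY lt]; exists y.
Qed.

Variable i0 : I.

(* The doors below carry all the labels of [C] but [i0]; a door leads to the
   rooms obtained by adding a point to [Y] or deleting an index from [C].
   Every door leads to two rooms, except [(set0, [set i0])] which leads to
   one, while a room has an even number of doors unless its label set is [C].
   By parity some room has label set [C]. *)
Definition room (r : {set X} * {set I}) : bool :=
  (#|r.1| == #|r.2|) && dominant r.1 r.2.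

Definition door (d : {set X} * {set I}) : bool :=
  [&& #|d.2| == #|d.1|.+1, dominant d.1 d.2, i0 \in d.2 & c @: d.1 == d.2 :\ i0].

Definition door_move (d : {set X} * {set I}) (z : X + I) :=
  match z with
  | inl x => (x |: d.1, d.2)
  | inr i => (d.1, d.2 :\ i)
  end.

Definition door_legal (d : {set X} * {set I}) (z : X + I) : bool :=
  match z with inl x => x \notin d.1 | inr i => i \in d.2 end.

Definition room_move (r : {set X} * {set I}) (z : X + I) :=
  match z with
  | inl x => (r.1 :\ x, r.2)
  | inr i => (r.1, i |: r.2)
  end.

Definition room_legal (r : {set X} * {set I}) (z : X + I) : bool :=
  match z with inl x => x \in r.1 | inr i => i \notin r.2 end.

Definition door_moves d := [set z | door_legal d z && room (door_move d z)].
Definition room_moves r := [set z | room_legal r z && door (room_move r z)].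

Lemma door_moveK d z : door_legal d z -> room_move (door_move d z) z = d.
Proof.
case: d => Y C; case: z => [x|i] /= h; first by rewrite setU1K.
by rewrite setD1K.
Qed.

Lemma room_moveK r z : room_legal r z -> door_move (room_move r z) z = r.
Proof.
case: r => Y C; case: z => [x|i] /= h; first by rewrite setD1K.
by rewrite setU1K.
Qed.

Lemma room_legal_move d z : door_legal d z -> room_legal (door_move d z) z.
Proof. by case: z => [x|i] /= h; rewrite !inE eqxx. Qed.

Lemma door_legal_move r z : room_legal r z -> door_legal (room_move r z) z.
Proof. by case: z => [x|i] /= h; rewrite !inE eqxx. Qed.

(** The same [z] leads from a door to a room and back, so both sides count the pairs of a door and
    an adjacent room. *)
Lemma count_incidences :
  \sum_(d | door d) #|door_moves d| = \sum_(r | room r) #|room_moves r|.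
Proof.
under eq_bigr do rewrite -sum1_card.
under [RHS]eq_bigr do rewrite -sum1_card.
rewrite !pair_big_dep /=.
rewrite (reindex_onto (fun p : _ * (X + I) => (room_move p.1 p.2, p.2))
  (fun p => (door_move p.1 p.2, p.2))) /=; last first.
  by move=> [d z] /=; rewrite inE => /andP[_ /andP[h _]]; rewrite door_moveK.
apply: eq_bigl => -[r z] /=; rewrite !inE.
apply/idP/idP.
  case/andP => /andP[hd /andP[h1 h2]] /eqP[e].
  have lr : room_legal r z by rewrite -e; exact: room_legal_move.
  by rewrite -[in room r]e h2 lr hd.
case/and3P => hr h1 h2; rewrite h2 (door_legal_move h1) /= room_moveK // hr /=.
by rewrite eqxx.
Qed.

Lemma setD1_inj_image (Y : {set X}) y :
  {in Y &, injective c} -> y \in Y -> c @: (Y :\ y) = (c @: Y) :\ c y.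
Proof.
move=> cI yY; apply/setP => j; rewrite !inE; apply/imsetP/andP.
  case=> x; rewrite !inE => /andP[xy xY ->]; split; last exact: imset_f.
  by apply: contra xy => /eqP/cI ->.
case=> jy /imsetP[x xY e]; exists x => //; rewrite !inE xY andbT.
by apply: contra jy => /eqP <-; rewrite e.
Qed.

(** If an index [i] can be added, [c] is injective on [Y], and the only other door deletes the point
    labelled [i]. Otherwise a door deletes some [y] whose label already occurs at exactly one other
    point [y'], and deleting [y'] is the second door. *)
Lemma room_moves_even r :
  room r -> c @: r.1 != r.2 -> ~~ odd #|room_moves r|.
Proof.
case: r => Y C /andP[/= /eqP cYC dom] ne.
have doorl y : y \in Y ->
    (inl y \in room_moves (Y, C)) = (i0 \in C) && (c @: (Y :\ y) == C :\ i0).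
  move=> yY; rewrite inE /= yY /door /= (dominantS _ _ dom) ?subD1set //.
  by rewrite -cYC (cardsD1 y Y) yY add1n eqxx.
have doorln y : y \notin Y -> (inl y \in room_moves (Y, C)) = false.
  by move=> yY; rewrite inE /= (negbTE yY).
have doorr i : (inr i \in room_moves (Y, C)) =
    [&& i \notin C, i0 \in C & c @: Y == i |: (C :\ i0)].
  rewrite inE /= /door /=; case: (boolP (i \in C)) => //= iC.
  rewrite cardsU1 iC add1n cYC eqxx /= (dominantS _ _ dom) ?subsetU1 //=.
  (* Adding [i0] itself would require the labels of [Y] to be all of [C], which [ne] excludes. *)
  rewrite !inE; case: (eqVneq i0 i) => [e|n0] /=.
    subst i; rewrite setU1K // (negbTE iC) /=.
    by rewrite (negbTE ne).
  case: (i0 \in C) => //=; congr (_ == _); apply/setP => k; rewrite !inE.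
  by case: (eqVneq k i0) => // ->; rewrite (negbTE n0).
case: (boolP [exists i, inr i \in room_moves (Y, C)]) => [/existsP[i hi]|].
  have := hi; rewrite doorr => /and3P[iC i0C /eqP e].
  have cinj : {in Y &, injective c}.
    apply/imset_injP; rewrite e cardsU1 !inE (negbTE iC) andbF add1n.
    by rewrite cYC (cardsD1 i0 C) i0C.
  have /imsetP[y yY ey] : i \in c @: Y by rewrite e !inE eqxx.
  have -> : room_moves (Y, C) = [set inl y; inr i].
    apply/setP => -[x|j]; rewrite [RHS]inE !in_set1.
      case: (boolP (x \in Y)) => xY; last first.
        rewrite doorln //; apply/esym/negbTE; apply: contra xY.
        by case/orP=> [/eqP[->]|/eqP].
      rewrite doorl // i0C /= orbF setD1_inj_image // e.
      apply/eqP/eqP => [H|[->]]; last first.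
        by rewrite -ey setU1K // !inE (negbTE iC) andbF.
      have /setP/(_ (c x)) := H; rewrite !inE eqxx /=.
      have : c x \in c @: Y by exact: imset_f.
      rewrite e !inE => /orP[/eqP cxi _|/andP[-> ->]] //.
      by congr inl; apply: cinj; rewrite // cxi.
    rewrite doorr i0C /=.
    apply/andP/eqP => [[jC /eqP e']|[->]]; last by rewrite e.
    have : j \in c @: Y by rewrite e' !inE eqxx.
    by rewrite e !inE (negbTE jC) andbF orbF => /eqP ->.
  by rewrite cards2.
rewrite negb_exists => /forallP nr.
case: (set_0Vmem (room_moves (Y, C))) => [->|[[y|i] hz]]; first by rewrite cards0.
  2: by have := nr i; rewrite hz.
have yY : y \in Y by apply: contraLR hz => /doorln ->.
have := hz; rewrite doorl // => /andP[i0C /eqP e].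
have cinj : {in Y :\ y &, injective c}.
  apply/imset_injP; rewrite e -(eqn_add2l 1).
  have := cardsD1 i0 C; rewrite i0C => <-.
  by rewrite -cYC (cardsD1 y Y) yY.
have cYE : c @: Y = c y |: (C :\ i0) by rewrite -(setD1K yY) imsetU1 e.
have cyC : c y \in C.
  apply: contraT => cyC; have := nr (c y).
  by rewrite doorr cyC i0C cYE eqxx.
have cy0 : c y != i0.
  by apply: contra ne => /eqP cy; rewrite cYE cy setD1K.
have /imsetP[y' y'Y ey] : c y \in c @: (Y :\ y) by rewrite e !inE cy0.
have /andP[y'y y'Y'] : (y' != y) && (y' \in Y) by move: y'Y; rewrite !inE.
have -> : room_moves (Y, C) = [set inl y; inl y'].
  apply/setP => -[x|j]; last by rewrite (negbTE (nr j)) !inE.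
  case: (boolP (x \in Y)) => xY; last first.
    rewrite doorln // !inE; apply/esym/negbTE; apply: contra xY.
    by case/orP=> /eqP[->].
  rewrite doorl // i0C /= [RHS]inE !in_set1.
  apply/eqP/orP => [H|[/eqP[->]//|/eqP[->]]]; last first.
    apply/eqP; rewrite eqEsubset; apply/andP; split; apply/subsetP => j.
      case/imsetP=> w; rewrite !inE => /andP[wy' wY] ->.
      have [->|wy] := eqVneq w y; first by rewrite cy0.
      have : c w \in c @: (Y :\ y) by apply: imset_f; rewrite !inE wy.
      by rewrite e !inE.
    rewrite -e => /imsetP[w]; rewrite !inE => /andP[wy wY ->].
    have [->|wy'] := eqVneq w y'; first by rewrite -ey imset_f // !inE eq_sym y'y.
    by rewrite imset_f // !inE wy'.
  have [->|xy] := eqVneq x y; first by left.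
  right; have : c x \in c @: (Y :\ x).
    by rewrite H -e; apply: imset_f; rewrite !inE xy.
  case/imsetP=> w; rewrite !inE => /andP[wx wY] exw.
  have [wy|wy] := eqVneq w y.
    apply/eqP; congr inl; apply: cinj; rewrite ?inE ?xy ?y'y //.
    by rewrite exw wy ey.
  case/eqP: wx; apply/esym; apply: cinj => //; by rewrite !inE ?xy ?wy.
by rewrite cards2 (inj_eq (@inl_inj _ _)) eq_sym y'y.
Qed.

(** Sending an index to the lowest member of [Y] in its ranking maps [C] onto [Y], with one index to
    spare. So exactly one pair [i], [j] shares its minimum, and releasing either of the two leads to
    exactly one room. *)
Lemma door_moves_card2 d : door d -> d.1 != set0 -> #|door_moves d| = 2.
Proof.
case: d => Y C /and4P[/= /eqP cC dom i0C _] /set0Pn[y0 y0Y].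
pose m i := [arg min_(y < y0 in Y) pos i y].
have mY i : m i \in Y by rewrite /m; case: arg_minnP.
have mle i y : y \in Y -> pos i (m i) <= pos i y.
  by rewrite /m; case: arg_minnP => // z _ h; exact: h.
have msurj y : y \in Y -> exists2 i, i \in C & m i = y.
  move=> yY; have [i iC h] := (dominantP _ _ dom) y; exists i => //.
  by apply: (pos_inj (i := i)); apply/eqP; rewrite eqn_leq mle // h.
have subm (A : {set I}) : (forall y, y \in Y -> exists2 i, i \in A & m i = y) ->
    m @: A = Y.
  move=> h; apply/setP => y; apply/imsetP/idP => [[i _ ->]//|/h[i iA <-]].
  by exists i.
have [i [j [iC jC ij mij]]] :
    exists i j, [/\ i \in C, j \in C, i != j & m i = m j].
  have /imset_injP/imset_injP ninj : ~ {in C &, injective m}.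
    by move/imset_injP; rewrite (subm C msurj) cC => /eqP/n_Sn.
  have /dinjectivePn[i iC [j]] : ~~ dinjectiveb m C.
    by apply/dinjectiveP => h; apply: ninj.
  rewrite !inE => /andP[ji jC] e; exists i, j; split=> //.
  by rewrite eq_sym.
have injD k : m @: (C :\ k) = Y -> k \in C -> {in C :\ k &, injective m}.
  move=> e kC; apply/imset_injP; rewrite e -(eqn_add2l 1).
  by have := cardsD1 k C; rewrite kC cC => <-.
have surjD k k' : k \in C -> k' \in C -> k != k' -> m k = m k' ->
    m @: (C :\ k) = Y.
  move=> kC k'C kk' e; apply: subm => y /msurj[l lC <-].
  have [->|lk] := eqVneq l k; last by exists l; rewrite ?inE ?lk.
  by exists k'; rewrite ?inE ?k'C ?andbT 1?eq_sym.
have surji := surjD _ _ iC jC ij mij.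
have surjj : m @: (C :\ j) = Y by apply: (surjD j i); rewrite // eq_sym.
(* These points compete to enter when index [k] is released. The highest of them in ranking [k]
   enters [Y]; if there is none, [k] can be deleted from [C]. *)
pose S k := [set x | [forall i in C :\ k, pos i (m i) < pos i x]].
have SP k x : reflect (forall i, i \in C :\ k -> pos i (m i) < pos i x) (x \in S k).
  by rewrite inE; apply: (iffP forall_inP).
pose P k (z : X + I) := match z with
  | inl x => x \in S k /\ forall x', x' \in S k -> pos k x' <= pos k x
  | inr l => l = k /\ S k = set0 end.
have Pex k : exists z, P k z.
  have [e|[x xS]] := set_0Vmem (S k); first by exists (inr k).
  pose w := [arg max_(y > x in S k) pos k y].
  by exists (inl w); rewrite /w /=; case: arg_maxnP.
have Pun k z z' : P k z -> P k z' -> z = z'.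
  case: z z' => [x|l] [x'|l'] /= [h1 h2] [h1' h2'].
  - congr inl; apply: (pos_inj (i := k)); apply/eqP.
    by rewrite eqn_leq h2 // h2'.
  - by move: h1; rewrite h2' inE.
  - by move: h1'; rewrite h2 inE.
  - by rewrite h1 h1'.
have nodom x : ~ forall l, l \in C -> pos l (m l) < pos l x.
  move=> h; have [l lC hl] := (dominantP _ _ dom) x.
  by have := h _ lC; rewrite ltnNge hl.
have Pmove k z : k \in C -> m @: (C :\ k) = Y -> P k z -> z \in door_moves (Y, C).
  move=> kC kY; case: z => [x|l] /= [h1 h2].
    have xY : x \notin Y.
      rewrite -kY; apply/imsetP => -[l lC e].
      by have /SP/(_ l lC) := h1; rewrite e ltnn.
    rewrite inE /= xY /room /= cardsU1 xY cC eqxx /=.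
    apply: contraT => /dominantPn[z hz].
    have zS : z \in S k.
      apply/SP => l lCk; have lC : l \in C by move: lCk; rewrite inE => /andP[].
      have [y] := hz _ lC; rewrite !inE => /orP[/eqP ->|yY] lt.
        by apply: ltn_trans lt; move/SP: h1; apply.
      by apply: leq_ltn_trans lt; exact: mle.
    have [y] := hz _ kC; rewrite !inE => /orP[/eqP ->|yY] lt.
      by move: lt; rewrite ltnNge h2.
    exfalso; apply: (nodom x) => l lC; have [->|lk] := eqVneq l k.
      by apply: leq_trans (h2 _ zS); apply: leq_ltn_trans lt; exact: mle.
    by move/SP: h1; apply; rewrite !inE lk.
  rewrite h1 inE /= kC /room /=.
  have := cardsD1 k C; rewrite kC cC add1n => -[<-]; rewrite eqxx /=.
  apply: contraT => /dominantPn[x hx].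
  have : x \in S k.
    by apply/SP => i' /hx[y yY]; apply: leq_ltn_trans; exact: mle.
  by rewrite h2 inE.
have moveP z : z \in door_moves (Y, C) -> P i z \/ P j z.
  rewrite inE; case: z => [x|k] /= /andP[h1 /andP[/= _ h2]].
    have [k kC hk] := (dominantP _ _ h2) x.
    have xk y : y \in Y -> pos k x <= pos k y by move=> yY; rewrite hk // !inE yY orbT.
    have other (k' : I) : (forall y, y \in Y -> pos k' x <= pos k' y) ->
        forall y, y \in Y -> exists l, [/\ l \in C, l != k, l != k' & m l = y].
      move=> hk' y yY; have yxY : y \in x |: Y by rewrite !inE yY orbT.
      have [l lC hl] := (dominantP _ _ h2) y.
      have ne (l' : I) : (forall y, y \in Y -> pos l' x <= pos l' y) -> l != l'.
        move=> hl'; apply: contra h1 => /eqP ll'.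
        suff -> : x = y by [].
        apply: (pos_inj (i := l)); apply/eqP; rewrite eqn_leq hl ?setU11 //.
        by rewrite ll' hl'.
      exists l; split=> //; [exact: ne|exact: ne|].
      apply: (pos_inj (i := l)); apply/eqP.
      by rewrite eqn_leq mle // hl // !inE mY orbT.
    (* In ranking [k] the new point [x] is the lowest, so the old points are the minima of the other
       indices. Hence [k] is one of the colliding pair. *)
    have surjk : m @: (C :\ k) = Y.
      apply: subm => y /(other _ xk)[l [lC lk _ e]].
      by exists l => //; rewrite !inE lk.
    have kij : k = i \/ k = j.
      have injk := injD _ surjk kC.
      have [|ki] := eqVneq k i; first by left.
      have [|kj] := eqVneq k j; first by right.
      by case/eqP: ij; apply: injk; rewrite ?inE ?iC ?jC 1?eq_sym ?ki ?kj.
    have xS : x \in S k.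
      apply/SP => l; rewrite !inE => /andP[lk lC]; rewrite ltnNge.
      apply/negP => hl.
      have /other h : forall y, y \in Y -> pos l x <= pos l y.
        by move=> y yY; apply: leq_trans hl _; exact: mle.
      have e : m @: (C :\ k :\ l) = Y.
        apply: subm => y /h[l' [l'C l'k l'l e]]; exists l' => //.
        by rewrite !inE l'l l'k.
      have := leq_imset_card m (C :\ k :\ l); rewrite e.
      have := cardsD1 k C; have := cardsD1 l (C :\ k).
      rewrite kC cC !inE lk lC /= !add1n => -> [->].
      by rewrite ltnn.
    have Pk : P k (inl x).
      split=> // x' /SP hx'; rewrite leqNgt; apply/negP => lt.
      have [l lC hl] := (dominantP _ _ h2) x'.
      have [e|lk] := eqVneq l k.
        by move: lt; rewrite ltnNge -e hl // setU11.
      have := hx' l; rewrite !inE lk lC ltnNge hl ?inE ?mY ?orbT // => /(_ isT).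
      by [].
    by case: kij => <-; [left|right].
  have Sk : S k = set0.
    have [//|[x /SP hx]] := set_0Vmem (S k).
    have [l lC hl] := (dominantP _ _ h2) x.
    by have := hx _ lC; rewrite ltnNge hl.
  have [e|ki] := eqVneq k i; first by left; rewrite /= -e.
  have [e|kj] := eqVneq k j; first by right; rewrite /= -e.
  (* Dominance without [k], tested at [m k], gives another index with the same minimum, so [k] is
     again one of the colliding pair. *)
  have [l lC hl] := (dominantP _ _ h2) (m k).
  have e : m k = m l.
    by apply: (pos_inj (i := l)); apply/eqP; rewrite eqn_leq mle ?hl.
  have inji := injD _ surji iC.
  move: lC; rewrite !inE => /andP[lk lC].
  have [li|li] := eqVneq l i.
    case/eqP: kj; apply: inji; rewrite ?inE ?h1 ?jC ?ki 1?eq_sym ?ij //.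
    by rewrite e li mij.
  by case/eqP: lk; apply: inji; rewrite ?inE ?h1 ?lC ?ki ?li.
have Pdisj z : P i z -> P j z -> False.
  case: z => [x|l] /= [h1 _] [h2 _]; last by case/eqP: ij; rewrite -h1 -h2.
  apply: (nodom x) => l lC; have [e|li] := eqVneq l i.
    by move/SP: h2; apply; rewrite !inE e ij.
  by move/SP: h1; apply; rewrite !inE li.
have [zi hi] := Pex i; have [zj hj] := Pex j.
have -> : door_moves (Y, C) = [set zi; zj].
  apply/setP => z; rewrite [RHS]inE !in_set1; apply/idP/orP => [/moveP[] h|].
  - by left; rewrite (Pun _ _ _ h hi).
  - by right; rewrite (Pun _ _ _ h hj).
  - by case=> /eqP ->; [apply: (Pmove i)|apply: (Pmove j)].
rewrite cards2; case: eqP => // e; exfalso; apply: (Pdisj zi) => //.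
by rewrite e.
Qed.

(** Only the highest point in ranking [i0] can be added; deleting [i0] would leave no index to
    dominate [x0]. *)
Lemma door_moves_start (x0 : X) : #|door_moves (set0, [set i0])| = 1.
Proof.
pose w := [arg max_(y > x0) pos i0 y].
suff -> : door_moves (set0, [set i0]) = [set inl w] by rewrite cards1.
apply/setP => -[x|i]; rewrite in_set1 inE /=.
  rewrite !inE /room /= setU0 !cards1 eqxx /=; apply/dominantP/eqP.
    move=> h; congr inl; apply: (pos_inj (i := i0)); apply/eqP; rewrite eqn_leq.
    have [i] := h w; rewrite inE => /eqP -> /(_ x (set11 x)) ->.
    by rewrite andbT /w; case: arg_maxnP => // z _ /(_ x isT).
  move=> [->] z; exists i0; rewrite ?inE // => y; rewrite inE => /eqP ->.
  by rewrite /w; case: arg_maxnP => // u _ /(_ z isT).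
rewrite /room /=; apply/andP => -[]; rewrite inE => /eqP ->.
case/andP=> _ /dominantP/(_ x0)[i1].
by rewrite setDv inE.
Qed.

Theorem scarf (x0 : X) :
  exists (Y : {set X}) (C : {set I}),
    [/\ #|Y| = #|C|, dominant Y C & c @: Y = C].
Proof.
have [/existsP[[Y C] /andP[/andP[/eqP h1 h2] /eqP h3]]|] :=
  boolP [exists r, room r && (c @: r.1 == r.2)]; first by exists Y, C.
rewrite negb_exists => /forallP nofull.
have ev : ~~ odd (\sum_(r | room r) #|room_moves r|).
  elim/big_rec: _ => // r k hr; rewrite oddD => /negbTE ->; rewrite addbF.
  by apply: room_moves_even => //; have := nofull r; rewrite hr.
have d0 : door (set0, [set i0]).
  rewrite /door /= cards1 cards0 eqxx set11 imset0 setDv eqxx !andbT /=.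
  by apply/dominantP => x; exists i0; rewrite ?inE // => y; rewrite inE.
move: ev; rewrite -count_incidences (bigD1 _ d0) /= (door_moves_start x0) oddD /=.
have -> : odd (\sum_(d | door d && (d != (set0, [set i0]))) #|door_moves d|) = false.
  (* A door with empty [Y] has a single index, necessarily [i0], so all the doors left here have two
     rooms. *)
  apply/negbTE; elim/big_rec: _ => // -[Y C] k /andP[hd ne].
  rewrite oddD => /negbTE ->; rewrite addbF door_moves_card2 //.
  apply: contra ne => /= /eqP Y0; move: hd; rewrite Y0 => /and4P[/= cC _ i0C _].
  move: cC; rewrite cards0 => /cards1P[i Ci]; move: i0C.
  by rewrite Ci inE => /eqP ->.
by [].
Qed.
End Scarf.

From mathcomp Require Import all_classical all_reals all_analysis.
From mathcomp Require Import ring lra zify.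
Import Order.TTheory GRing.Theory Num.Theory.
Import numFieldNormedType.Exports.
Local Open Scope classical_set_scope.
Local Open Scope ring_scope.

(** * Closed covers of the simplex *)

Section grid.
Local Open Scope nat_scope.
Variables (L N : nat).

Definition grid_point := {x : {ffun 'I_L -> 'I_N.+1} | (\sum_i x i == N :> nat)%N}.

(** Ranking by coordinate [i], with ties broken by the enumeration, since Scarf's lemma needs
    injective rankings. *)
Definition grid_pos (i : 'I_L) (x : grid_point) : nat :=
  (sval x i * #|{: grid_point}| + enum_rank x)%N.

Lemma grid_pos_inj i : injective (grid_pos i).
Proof.
move=> x y /(congr1 (modn^~ #|{: grid_point}|)).
rewrite /grid_pos !modnMDl !modn_small; try exact: ltn_ord.
by move/val_inj/enum_rank_inj.
Qed.

Lemma grid_pos_le i x y : grid_pos i x <= grid_pos i y -> sval x i <= sval y i.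
Proof.
rewrite /grid_pos => h; rewrite leqNgt; apply/negP => lt.
have hy := ltn_ord (enum_rank y).
have : (sval y i).+1 * #|{: grid_point}| <= sval x i * #|{: grid_point}|.
  by rewrite leq_mul2r lt orbT.
rewrite mulSn => h2; move: h; rewrite leqNgt => /negP; apply.
apply: leq_trans (leq_addr _ _); apply: leq_trans h2.
by rewrite addnC ltn_add2r.
Qed.

Lemma grid_pointP (f : 'I_L -> nat) : \sum_i f i = N ->
  exists x : grid_point, forall i, sval x i = f i :> nat.
Proof.
move=> h; have fN i : f i < N.+1 by rewrite ltnS -h (bigD1 i) //= leq_addr.
pose g := [ffun i => Ordinal (fN i)].
have hg : (\sum_i g i == N)%N.
  by rewrite -[X in _ == X]h; apply/eqP/eq_bigr => i _; rewrite ffunE.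
by exists (exist _ g hg) => i; rewrite /= ffunE.
Qed.

(** The pair [(Y, C)] from Scarf's lemma has diameter at most [L] in each coordinate: on [C] the
    coordinates exceed their minima by at most [L], and off [C] they are at most [L]. All labels in
    [C] occur on [Y]. *)
Lemma grid_labelling (i0 : 'I_L) (c : grid_point -> 'I_L) :
  exists z : grid_point, forall i : 'I_L,
    (exists y : grid_point, c y = i /\
      forall l, sval y l <= sval z l + L /\ sval z l <= sval y l + L)
    \/ sval z i <= L.
Proof.
have [x0 _] : exists x0 : grid_point, forall i,
    sval x0 i = (if i == i0 then N else 0) :> nat.
  by apply: grid_pointP; rewrite -big_mkcond big_pred1_eq.
have [Y [C [cYC dom e]]] := scarf c (@grid_pos_inj) i0 x0.
have [z zY] : exists z, z \in Y.
  apply/set0Pn; rewrite -card_gt0 cYC card_gt0.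
  by have [i iC _] := (dominantP _ _ _ dom) x0; apply/set0Pn; exists i.
have [i1 i1C] : exists i, i \in C by exists (c z); rewrite -e imset_f.
pose m i := sval [arg min_(y < z in Y) sval y i] i : nat.
have mle i y : y \in Y -> m i <= sval y i.
  by rewrite /m; case: arg_minnP => // w _ h; exact: h.
have mex i : exists2 y, y \in Y & m i = sval y i.
  by exists [arg min_(y < z in Y) sval y i] => //; case: arg_minnP.
have sumy (y : grid_point) : \sum_i sval y i = N :> nat by case: y => y hy; exact/eqP.
(* Otherwise there is room for a grid point whose coordinates in [C] all exceed the minima by at
   least one (the surplus goes to [i1]), against dominance. *)
have key : N < \sum_(i in C) m i + L.
  rewrite ltnNge; apply/negP => hle.
  have hC : \sum_(i in C) (m i).+1 <= N.
    apply: leq_trans hle; under eq_bigr do rewrite -addn1.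
    by rewrite big_split /= leq_add2l sum1_card -[X in _ <= X]card_ord max_card.
  pose f i := (if i \in C then (m i).+1 else 0) +
     (if i == i1 then N - \sum_(i in C) (m i).+1 else 0).
  have [x hx] : exists x : grid_point, forall i, sval x i = f i :> nat.
    apply: grid_pointP; rewrite big_split /= -big_mkcond -[X in _ + X]big_mkcond.
    by rewrite big_pred1_eq subnKC.
  have [i iC hi] := (dominantP _ _ _ dom) x.
  have [y yY my] := mex i.
  have := grid_pos_le (hi y yY); rewrite hx /f iC my addSn ltnNge.
  by rewrite leq_addr.
have upC y i : y \in Y -> i \in C -> sval y i <= m i + L.
  move=> yY iC; have := sumy y; rewrite (bigID (mem C)) /= => h.
  have h1 : \sum_(j in C) sval y j <= N by rewrite -[X in _ <= X]h leq_addr.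
  rewrite (bigD1 i) //= in h1; rewrite (bigD1 i) //= in key.
  have h2 : \sum_(j in C | j != i) m j <= \sum_(j in C | j != i) sval y j.
    by apply: leq_sum => j _; exact: mle.
  have ar a b s t : a + s <= N -> N < b + t + L -> t <= s -> a <= b + L by lia.
  exact: ar h1 key h2.
have upn y i : y \in Y -> i \notin C -> sval y i <= L.
  move=> yY iC; have := sumy y; rewrite (bigID (mem C)) /=.
  rewrite [X in _ + X](bigD1 i) //= => h.
  have h2 : \sum_(j in C) m j <= \sum_(j in C) sval y j.
    by apply: leq_sum => j _; exact: mle.
  have ar a b s t : s + (a + b) = N -> N < t + L -> t <= s -> a <= L by lia.
  exact: ar h key h2.
exists z => i; case: (boolP (i \in C)) => iC; last by right; exact: upn.
left; have /imsetP[y yY ey] : i \in c @: Y by rewrite e.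
exists y; split=> // l; case: (boolP (l \in C)) => lC.
  by split; apply: leq_trans (upC _ _ _ lC) _; rewrite // leq_add2r; exact: mle.
by split; apply: leq_trans (upn _ _ _ lC) _; rewrite // leq_addl.
Qed.
End grid.

(** * Limits along an ultrafilter on the integers *)

Section ultra.
Variables (R : realType) (U : set_system nat).
Hypothesis UU : UltraFilter U.

Lemma ultra_or (P Q : nat -> Prop) :
  (\forall k \near U, P k \/ Q k) -> (\forall k \near U, P k) \/ \forall k \near U, Q k.
Proof.
move=> PQ; have [|nP] := in_ultra_setVsetC P UU; first by left.
by right; near=> k; have [] : P k \/ Q k; [near: k| |] => // Pk;
  have : ~ P k by near: k.
Unshelve. all: by end_near. Qed.

Lemma ultra_image_filter (T : Type) (f : nat -> T) : UltraFilter (f @ U).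
Proof.
split; first exact: fmap_proper_filter.
move=> G PG sG; rewrite predeqE => A; split; last exact: sG.
move=> GA; have [//|nA] := in_ultra_setVsetC (f @^-1` A) UU.
exfalso; have : G (~` A) by exact: sG.
by move=> /(filterI GA); rewrite setICr => /filter_ex[].
Qed.

Lemma ultra_cvg_ex (x : nat -> R) (a b : R) :
  (\forall k \near U, a <= x k <= b) ->
  exists2 l, a <= l <= b & x @ U --> l.
Proof.
move=> xab; have := @segment_compact R a b; rewrite compact_ultra.
move=> /(_ _ (ultra_image_filter x)) [|l []].
  by near=> k; rewrite /= in_itv /=; near: k.
by rewrite /= in_itv /= => lab xl; exists l.
Unshelve. all: by end_near. Qed.
End ultra.

Lemma filter_forall_fin {T : Type} {I : finType} (F : set_system T)
    (P : I -> T -> Prop) : Filter F ->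
  (forall i, \forall t \near F, P i t) -> \forall t \near F, forall i, P i t.
Proof.
move=> FF h; suff : \forall t \near F, forall i, i \in enum I -> P i t.
  by apply: filterS => t ht i; apply: ht; rewrite mem_enum.
elim: (enum I) => [|i s IH]; first by apply: filterS filterT.
near=> t => j; rewrite inE => /orP[/eqP ->|js]; first by near: t; exact: h.
by move: j js; near: t.
Unshelve. all: by end_near. Qed.

Lemma cvg_row {R : realType} {T : Type} {n : nat} (F : set_system T)
    (f : T -> 'rV[R]_n) (l : 'rV[R]_n) : Filter F ->
  (forall i, (f t ord0 i @[t --> F]) --> l ord0 i) -> f @ F --> l.
Proof.
move=> FF h A [P hP sPA].
have : \forall t \near F, forall i, P ord0 i (f t ord0 i).
  by apply: filter_forall_fin => i; exact: h.
by apply: filterS => t ht; apply: sPA => i j; rewrite ord1.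
Qed.

Lemma continuous_coord {R : realType} {T : topologicalType} {n : nat}
    (f : T -> 'rV[R]_n) (i : 'I_n) :
  continuous f -> continuous (fun t => f t ord0 i).
Proof.
move=> cf t.
apply: (@cvg_comp _ _ _ f (fun v : 'rV[R]_n => v ord0 i) _ _ _ (cf t)).
exact: coord_continuous.
Qed.

Definition simplex {R : realType} (L : nat) : set 'rV[R]_L :=
  [set a | orthant L a /\ \sum_i a ord0 i = 1].

Arguments simplex {R} L _.

Lemma simplex_le1 {R : realType} L (a : 'rV[R]_L) i : simplex L a -> a ord0 i <= 1.
Proof.
by case=> a0 <-; rewrite (bigD1 i) //= lerDl; apply: sumr_ge0 => j _; exact: a0.
Qed.

(** Label each grid point by a set containing it. The points given by [grid_labelling] on ever finer
    grids have a limit [a]; for each [i] it is either a limit of points of [A i] or has [i]-th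
    coordinate zero, and then the face hypothesis applies. *)
Lemma closed_cover_simplex {R : realType} {L : nat} (A : 'I_L -> set 'rV[R]_L) :
  (0 < L)%N ->
  (forall i, closed (A i)) ->
  (forall i a, simplex L a -> a ord0 i = 0 -> A i a) ->
  (forall a, simplex L a -> exists i, A i a) ->
  exists2 a, simplex L a & forall i, A i a.
Proof.
move=> L0 Acl Aface Acov.
pose i0 := Ordinal L0.
pose pt N (x : grid_point L N.+1) : 'rV[R]_L := \row_i ((sval x i)%:R / N.+1%:R).
have ptS N x : simplex L (pt N x).
  split=> [i|]; first by rewrite mxE divr_ge0.
  under eq_bigr do rewrite mxE.
  rewrite -mulr_suml -natr_sum; case: x => x /= /eqP ->.
  by rewrite divff // pnatr_eq0.
have /choice[z hz] : forall N : nat, exists z : 'rV[R]_L, simplex L z /\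
    forall i, (exists y, [/\ simplex L y, A i y &
       forall l, `|y ord0 l - z ord0 l| <= L%:R / N.+1%:R]) \/
      z ord0 i <= L%:R / N.+1%:R.
  move=> N; have /choice[c hc] : forall x : grid_point L N.+1, exists i, A i (pt _ x).
    by move=> x; apply: Acov.
  have [z hz] := grid_labelling i0 c; exists (pt _ z); split=> // i.
  have [[y [cy yz]]|zi] := hz i; last first.
    by right; rewrite mxE ler_pM2r ?invr_gt0 ?ltr0n // ler_nat.
  left; exists (pt _ y); split; rewrite -?cy // => l.
  rewrite !mxE -mulrBl normrM [X in _ * X]ger0_norm ?invr_ge0 //.
  rewrite ler_pM2r ?invr_gt0 ?ltr0n // ler_norml.
  by have [] := yz l; rewrite -!(ler_nat R) !natrD; lra.
have [U [UU oU]] := ultraFilterLemma (@eventually_filter).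
have /choice[l hl] : forall i, exists l : R, 0 <= l <= 1 /\ z N ord0 i @[N --> U] --> l.
  move=> i; have [|l l01 zl] := ultra_cvg_ex (x := fun N => z N ord0 i) (a := 0) (b := 1) UU.
    apply: filterE => N; have [zS _] := hz N.
    by rewrite (simplex_le1 _ zS) andbT; case: zS => ->.
  by exists l.
pose a : 'rV[R]_L := \row_i l i.
have eps0 : L%:R / N.+1%:R @[N --> U] --> (0 : R).
  apply: cvg_trans (_ : (L%:R / N.+1%:R @[N --> \oo]) --> (0:R)).
    exact: cvg_app.
  rewrite -[X in _ --> X](mulr0 L%:R); apply: cvgM; first exact: cvg_cst.
  exact: cvg_harmonic.
have aS : simplex L a.
  split=> [i|]; first by rewrite mxE; have [/andP[]] := hl i.
  have h : \sum_i z N ord0 i @[N --> U] --> \sum_i a ord0 i.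
    apply: cvg_big => [|i _]; first exact: add_continuous.
    by rewrite mxE; have [] := hl i.
  apply/esym; apply: cvg_unique h => //=.
  under eq_fun do rewrite (proj2 (proj1 (hz _))).
  exact: cvg_cst.
exists a => // i.
have [hy|hzi] : (\forall N \near U, exists y, [/\ simplex L y, A i y &
       forall l, `|y ord0 l - z N ord0 l| <= L%:R / N.+1%:R]) \/
      \forall N \near U, z N ord0 i <= L%:R / N.+1%:R.
  by apply: ultra_or; apply: filterE => N; have [_] := hz N; apply.
- have /choice[y yP] : forall N, exists y, (exists y, [/\ simplex L y, A i y &
       forall l, `|y ord0 l - z N ord0 l| <= L%:R / N.+1%:R]) ->
       [/\ simplex L y, A i y &
       forall l, `|y ord0 l - z N ord0 l| <= L%:R / N.+1%:R].
    by move=> N; have [[y ?]|n] := pselect (exists y, [/\ simplex L y, A i y &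
       forall l, `|y ord0 l - z N ord0 l| <= L%:R / N.+1%:R]); [exists y|exists 0].
  apply: (closed_cvg (A i) (u_ := y) (F := U)) => //.
    by near=> N; have [] : [/\ simplex L (y N), A i (y N) &
       forall l, `|y N ord0 l - z N ord0 l| <= L%:R / N.+1%:R];
      [apply: yP; near: N|].
  apply: cvg_row => j; rewrite mxE.
  have -> : (fun N => y N ord0 j) =
     (fun N => z N ord0 j + (y N ord0 j - z N ord0 j)).
    by apply/funext => N; rewrite addrC subrK.
  rewrite -[X in _ --> X](addr0 (l j)); apply: cvgD; first by have [] := hl j.
  apply/norm_cvg0P; apply: squeeze_cvgr (cvg_cst (0 : R)) eps0.
  near=> N; rewrite normr_ge0 /=.
  by have [] : [/\ simplex L (y N), A i (y N) &
       forall l, `|y N ord0 l - z N ord0 l| <= L%:R / N.+1%:R];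
      [apply: yP; near: N|].
- apply: Aface => //; rewrite mxE; have [/andP[l0 _] zl] := hl i.
  apply/eqP; rewrite eq_le l0 andbT.
  exact: ler_cvg_to zl eps0 hzi.
Unshelve. all: by end_near. Qed.

(** * The discretised radial problem *)

Section euler.
Variables (R : realType) (n L : nat) (B : 'rV[R]_L -> 'rV[R]_L) (M : R).
Hypothesis n0 : (0 < n)%N.
Hypothesis B0M : forall u i, 0 <= B u ord0 i <= M.

(** At [s = j h] the scheme reads [2 j (g' - g) = - (B u + n g')]; solving for the new slope [g']
    produces this weight. *)
Definition step_weight (j : nat) : R := n%:R / (j.*2 + n)%:R.

(* In the variable [s = |x|^2] the radial profile [p] and [g = 2 p'] solve
   [2 s g' = - (B p + n g)]. Treating [g] implicitly removes the singularity
   at [s = 0]: the new slope is a convex combination of the old slope and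
   [- B u / n], and the step [h] cancels from the weight. *)
Fixpoint euler (h : R) (a : 'rV[R]_L) (j : nat) : 'rV[R]_L * 'rV[R]_L :=
  if j is j'.+1 then
    let ug := euler h a j' in
    let g := (1 - step_weight j') *: ug.2 - (step_weight j' / n%:R) *: B ug.1 in
    (ug.1 + (h / 2) *: g, g)
  else (a, - n%:R^-1 *: B a).

Local Notation u h a j := (euler h a j).1.
Local Notation g h a j := (euler h a j).2.

Lemma step_weight_bounds j : 0 <= step_weight j <= 1.
Proof.
rewrite /step_weight divr_ge0 //= ler_pdivrMr ?ltr0n ?addn_gt0 ?n0 ?orbT //.
by rewrite mul1r ler_nat leq_addl.
Qed.

Let nR : 1 <= n%:R :> R. Proof. by rewrite ler1n. Qed.

(** Each [n g] is a convex combination of past values of [- B u]. This serves twice: for global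
    slope bounds, and for the limit slope at [s = 0], where Lipschitz bounds on [g] degenerate. *)
Lemma euler_slope_near h a j c (b e : R) :
  `|B a ord0 c - b| <= e ->
  (forall i, (i < j)%N -> `|B (u h a i) ord0 c - b| <= e) ->
  `|n%:R * g h a j ord0 c + b| <= e.
Proof.
move=> h0; elim: j => [_|j IH hj] /=.
  by rewrite !mxE mulNr mulrN mulVKf ?gt_eqF ?(lt_le_trans ltr01) // addrC distrC.
have {}IH := IH (fun i ij => hj i (ltnW ij)).
rewrite !mxE; have {}hj := hj j (ltnSn j).
have /andP[w0 w1] := step_weight_bounds j.
move: (step_weight j) w0 w1 => w w0 w1; move: IH hj.
move: (g h a j ord0 c) (B _ ord0 c) => y x.
have -> : n%:R * ((1 - w) * y - w / n%:R * x) + b =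
   (1 - w) * (n%:R * y + b) - w * (x - b).
  by field; rewrite gt_eqF ?(lt_le_trans ltr01).
move=> h1 h2; apply: le_trans (ler_normB _ _) _; rewrite !normrM.
rewrite (ger0_norm w0) ger0_norm ?subr_ge0 //.
have := ler_wpM2l w0 h2; have w1' : 0 <= 1 - w by rewrite subr_ge0.
by have := ler_wpM2l w1' h1; lra.
Qed.

Lemma euler_slope_bounds h a j c : - M <= g h a j ord0 c <= 0.
Proof.
suff /andP[h1 h2] : - M <= n%:R * g h a j ord0 c <= 0.
  have g0 : g h a j ord0 c <= 0.
    by move: h2; rewrite pmulr_rle0 // (lt_le_trans ltr01).
  rewrite g0 andbT; apply: le_trans h1 _; rewrite -[leRHS]mul1r.
  by rewrite ler_wnM2r.
(* The interval from [0] to [M] as a ball, to fit [euler_slope_near]. *)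
have Bs v : `|B v ord0 c - M / 2| <= M / 2.
  by have := B0M v c; rewrite ler_norml; lra.
have := @euler_slope_near h a j c (M / 2) (M / 2) (Bs _) (fun _ _ => Bs _).
by rewrite ler_norml; lra.
Qed.

Lemma euler_step_bounds h a j c : 0 <= h ->
  u h a j ord0 c - h * M <= u h a j.+1 ord0 c <= u h a j ord0 c.
Proof.
move=> h0; have -> : u h a j.+1 ord0 c = u h a j ord0 c + h / 2 * g h a j.+1 ord0 c.
  by rewrite /= [LHS]mxE; congr (_ + _); exact: mxE.
have := euler_slope_bounds h a j.+1 c.
by move: (g h a j.+1 ord0 c) (u h a j ord0 c) => y x /andP[]; nra.
Qed.

Lemma euler_nincr h a i j c : 0 <= h -> (i <= j)%N ->
  u h a j ord0 c <= u h a i ord0 c.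
Proof.
move=> h0; elim: j => [|j IH]; first by rewrite leqn0 => /eqP ->.
rewrite leq_eqVlt => /orP[/eqP -> //|/IH]; apply: le_trans.
by have /andP[] := euler_step_bounds a j c h0.
Qed.

Hypothesis B_cont : continuous B.

Lemma euler_continuous h j :
  continuous (fun a => u h a j) /\ continuous (fun a => g h a j).
Proof.
elim: j => [|j [IHu IHg]] /=.
  split; first by move=> a; exact: cvg_id.
  by move=> a; apply: (@cvgZl_tmp _ _ _ (nbhs a) _); exact: B_cont.
have cg : continuous (fun a => (1 - step_weight j) *: g h a j -
    (step_weight j / n%:R) *: B (u h a j)).
  move=> a; apply: (@cvgB _ _ _ (nbhs a) _); apply: (@cvgZl_tmp _ _ _ (nbhs a) _); first exact: IHg.
  by apply: (@continuous_comp _ _ _ (fun a => u h a j) B); [exact: IHu|exact: B_cont].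
split=> // a; apply: (@cvgD _ _ _ (nbhs a) _); first exact: IHu.
by apply: (@cvgZl_tmp _ _ _ (nbhs a) _); exact: cg.
Qed.

(* [A i] below collects the initial data for which component [i] has become
   nonpositive while no component is below zero by more than one step. As the
   components are nonincreasing, a common point of all the [A i] starts an
   orbit that vanishes up to one step at the last of the times involved. *)
Lemma discrete_shooting (h : R) (J : nat) : (0 < L)%N -> 0 <= h ->
  exists a j, [/\ simplex L a, (j <= J)%N,
    forall i, - (h * M) <= u h a j ord0 i &
    j = J \/ forall i, u h a j ord0 i <= 0].
Proof.
move=> L0 h0.
have uc j i : continuous (fun a => u h a j ord0 i).
  by apply: continuous_coord; have [] := euler_continuous h j.
have [[a [aS apos]]|noex] := pselect (exists a, simplex L a /\
    forall j i, (j <= J)%N -> 0 < u h a j ord0 i).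
  exists a, J; split=> //; last by left.
  move=> i; apply: le_trans (ltW (apos J i (leqnn J))).
  rewrite oppr_le0 mulr_ge0 //.
  by have /andP[M0 /(le_trans M0)] := B0M 0 i.
pose A (i : 'I_L) := \bigcup_(j in `I_J.+1)
  ((\bigcap_l [set a | - (h * M) <= u h a j ord0 l]) `&`
     [set a | u h a j ord0 i <= 0]).
have [|||a aS aA] := @closed_cover_simplex R L A L0.
- move=> i; apply: closed_bigcup; first exact: finite_II.
  move=> j _; apply: closedI.
    apply: closed_bigI => l _.
    by apply: (preimage_closed _ (@closed_ge R (- (h * M)))) => y _; exact: uc.
  by apply: (preimage_closed _ (@closed_le R 0)) => y _; exact: uc.
- move=> i a [a0 _] ai; exists 0%N => //=; split=> [l _|] /=; last by rewrite ai.
  apply: le_trans (a0 l); rewrite oppr_le0 mulr_ge0 //.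
  by have /andP[M0 /(le_trans M0)] := B0M 0 i.
- move=> a aS.
  have ex : exists j, (j <= J)%N && [exists i, u h a j ord0 i <= 0].
    apply: contrapT => nj; apply: noex; exists a; split=> // j i jJ.
    rewrite ltNge; apply/negP => hle; apply: nj; exists j; rewrite jJ /=.
    by apply/existsP; exists i.
  (* At the first time some component is nonpositive, all were positive one step earlier (or
     [j = 0]), so none has dropped below [- h M]. *)
  case: (ex_minnP ex) => j /andP[jJ /existsP[i hi]] jmin.
  exists i, j => //; split=> // l _ /=.
  case: j jJ hi jmin => [|j] jJ hi jmin.
    case: aS => a0 _; apply: le_trans (a0 l); rewrite oppr_le0 mulr_ge0 //.
    by have /andP[M0 /(le_trans M0)] := B0M 0 i.
  have /andP[+ _] := euler_step_bounds a j l h0; apply: le_trans.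
  rewrite lerBrDr addNr leNgt; apply/negP => hlt.
  have := jmin j; rewrite (ltnW jJ) ltnn /= => h1.
  suff : false by [].
  by apply: h1; apply/existsP; exists l; exact: ltW.
have /choice[j hj] : forall i, exists j, [/\ (j <= J)%N,
    forall l, - (h * M) <= u h a j ord0 l & u h a j ord0 i <= 0].
  move=> i; have [j jJ [h1 h2]] := aA i; exists j; split=> //.
  by move=> l; apply: h1.
pose i0 := Ordinal L0.
pose k := [arg max_(i > i0) j i].
exists a, (j k); have [kJ h1 _] := hj k; split=> //; right=> i.
have [_ _ hi] := hj i; apply: le_trans hi; apply: euler_nincr => //.
by rewrite /k; case: arg_maxnP => // l _; apply.
Qed.
End euler.

(** * Passage to the limit *)

Lemma cvg_near_lt {R : realType} {T : Type} {F : set_system T} {FF : Filter F}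
    {f : T -> R} {l : R} : f @ F --> l ->
  forall e, 0 < e -> \forall t \near F, `|l - f t| < e.
Proof. by move/cvgrPdist_lt. Qed.

Lemma cvg_near_le {R : realType} {T : Type} {F : set_system T} {FF : Filter F}
    {f : T -> R} {l : R} : f @ F --> l ->
  forall e, 0 < e -> \forall t \near F, `|l - f t| <= e.
Proof. by move/cvgrPdist_le. Qed.

Lemma near_dist {R : realType} (x : R) (d : R) : 0 < d -> \forall t \near x, `|x - t| < d.
Proof. exact: (cvg_near_lt (@cvg_id _ (nbhs x))). Qed.

Lemma cvg_const_eq {R : realType} {T : Type} {F : set_system T} {FF : ProperFilter F}
    {f : T -> R} {l c : R} : f @ F --> l -> (\forall t \near F, f t = c) -> l = c.
Proof.
move=> fl fc; apply/eqP; rewrite eq_le; apply/andP; split.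
  by apply: (cvgr_to_le fl); apply: filterS fc => t ->.
by apply: (cvgr_to_ge fl); apply: filterS fc => t ->.
Qed.

Lemma cvg_sumr {R : realType} {T : Type} {I : finType} {F : set_system T}
    {FF : Filter F} (f : I -> T -> R) (l : I -> R) : (forall i, f i @ F --> l i) ->
  (fun t => \sum_i f i t) @ F --> \sum_i l i.
Proof. by move=> fl; apply: cvg_big => [|i _]; [exact: add_continuous|exact: fl]. Qed.

Lemma is_derive_littleo {R : realType} {V : normedModType R} (f : V -> R) (x v : V)
    (d : R) :
  (forall e, 0 < e -> \forall t \near (0 : R), `|f (x + t *: v) - f x - t * d| <= e * `|t|) ->
  is_derive x v f d.
Proof.
move=> H; have c : (h^-1 *: ((f \o shift x) (h *: v) - f x)) @[h --> 0^'] --> d.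
  apply/cvgrPdist_le => e e0; near=> t.
  have t0 : t != 0 by near: t; exact: nbhs_dnbhs_neq.
  rewrite /= /GRing.scale /= distrC [t *: v + x]addrC.
  have -> : t^-1 * (f (x + t *: v) - f x) - d = t^-1 * (f (x + t *: v) - f x - t * d).
    by rewrite [RHS]mulrBr mulKf.
  rewrite normrM normfV ler_pdivrMl ?normr_gt0 // [leRHS]mulrC.
  by near: t; apply: nbhs_dnbhs; exact: H.
by split; [apply/cvg_ex; exists d|exact: cvg_lim].
Unshelve. all: by end_near. Qed.

(** * From node values to functions of continuous time *)

Section sampling.
Variables (R : realType) (U : set_system nat).
Hypotheses (UU : UltraFilter U) (oU : \oo `<=` U).

Definition mesh (k : nat) : R := k.+1%:R^-1.
(** Truncation sends negative times to node [0], so limits extend to the left of [0] as constants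
    and [0] needs no one-sided notions. *)
Definition node (k : nat) (s : R) : nat := Num.truncn (s * k.+1%:R).

Lemma mesh_gt0 k : 0 < mesh k. Proof. by rewrite invr_gt0 ltr0n. Qed.

Lemma cvg_mesh : mesh @ U --> (0 : R).
Proof.
apply: cvg_trans (_ : mesh @ \oo --> (0:R)); first exact: cvg_app.
exact: cvg_harmonic.
Qed.

Lemma node_bounds k s : 0 <= s -> (node k s)%:R * mesh k <= s < (node k s)%:R * mesh k + mesh k.
Proof.
move=> s0.
have /andP[h1] : (node k s)%:R <= s * k.+1%:R < (node k s).+1%:R.
  by apply: truncn_itv; rewrite mulr_ge0.
rewrite -[X in _ < X]natr1 => h2.
have m0 := mesh_gt0 k; have e : k.+1%:R * mesh k = 1.
  by rewrite /mesh mulfV // pnatr_eq0.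
have h3 := ler_wpM2r (ltW m0) h1.
have h4 : s * k.+1%:R * mesh k < ((node k s)%:R + 1) * mesh k by rewrite ltr_pM2r.
move: h3 h4; rewrite -mulrA e mulr1 mulrDl mul1r => -> ->.
by [].
Qed.

Lemma node_nonpos k s : s <= 0 -> node k s = 0%N.
Proof.
move=> s0; apply/truncn0Pn; rewrite -ltNge; apply: le_lt_trans ltr01.
by rewrite mulr_le0_ge0.
Qed.

Lemma le_node k s t : s <= t -> (node k s <= node k t)%N.
Proof. by move=> st; apply: le_truncn; rewrite ler_wpM2r. Qed.

Lemma node_diff k s t : s <= t ->
  ((node k t)%:R - (node k s)%:R) * mesh k <= t - s + mesh k.
Proof.
move=> st; have m0 := mesh_gt0 k; have [s0|s0] := leP 0 s.
  have /andP[h1 h2] := node_bounds k s0.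
  by have /andP[h3 h4] := node_bounds k (le_trans s0 st); lra.
rewrite (node_nonpos _ (ltW s0)) subr0; have [t0|t0] := leP 0 t.
  by have /andP[h3 h4] := node_bounds k t0; lra.
by rewrite (node_nonpos _ (ltW t0)) mul0r; lra.
Qed.

(* Neighbourhoods of the time [s] that are uniform over the nodes and
   eventual in the mesh index along [U]. *)
Definition near_node (s : R) : set_system (nat * nat) :=
  [set P | exists2 d, 0 < d & \forall k \near U,
     forall j, `|j%:R * mesh k - s| < d -> P (k, j)].

#[local] Instance near_node_filter s : Filter (near_node s).
Proof.
split.
- by exists 1 => //; apply: filterE.
- move=> P Q [d d0 hP] [e e0 hQ]; exists (Num.min d e).
    by rewrite lt_min d0.
  near=> k => j; rewrite lt_min => /andP[h1 h2]; split; move: j h1 h2.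
    by move=> j h1 _; move: j h1; near: k.
  by move=> j _; move: j; near: k.
- move=> P Q PQ [d d0 hP]; exists d => //; near=> k => j hj; apply: PQ.
  by move: j hj; near: k.
Unshelve. all: by end_near. Qed.

Lemma node_near (s t d : R) : 0 <= s -> `|t - s| < d ->
  \forall k \near U, `|(node k t)%:R * mesh k - s| < d.
Proof.
move=> s0 ts; have [t0|t0] := leP 0 t; last first.
  apply: filterE => k; rewrite node_nonpos ?ltW // mul0r.
  apply: le_lt_trans ts; rewrite sub0r normrN ger0_norm // ler0_norm; lra.
have dts : 0 < d - `|t - s| by rewrite subr_gt0.
apply: filterS (cvg_near_lt cvg_mesh dts) => k; rewrite sub0r normrN gtr0_norm ?mesh_gt0 // => mk.
have /andP[h1 h2] := node_bounds k t0.
move: ts mk; rewrite !ltr_norml => /andP[h3 h4].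
by case: (lerP 0 (t - s)) => h; [rewrite ger0_norm //|rewrite ltr0_norm //]; lra.
Qed.

Lemma near_node_cvg (s : R) : 0 <= s ->
  (fun p => p.2%:R * mesh p.1) @ near_node s --> s.
Proof.
move=> s0; apply/cvgrPdist_lt => e e0; exists e => //; apply: filterE => k j.
by rewrite distrC.
Qed.

Lemma near_node_mesh s : (fun p => mesh p.1) @ near_node s --> (0 : R).
Proof.
apply/cvgrPdist_lt => e e0; exists 1 => //.
by apply: filterS (cvg_near_lt cvg_mesh e0) => k hk j _.
Qed.

Lemma near_node_sample (P : nat * nat -> Prop) s :
  (\forall p \near near_node s, P p) ->
  0 <= s -> exists2 d, 0 < d & forall t, `|t - s| < d -> \forall k \near U, P (k, node k t).
Proof.
move=> [d d0 hP] s0; exists d => // t ts; near=> k.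
have : `|(node k t)%:R * mesh k - s| < d by near: k; exact: node_near.
by move: (node k t); near: k.
Unshelve. all: by end_near. Qed.

(** Closeness of the samples to [l] holds on a whole time interval around [s], and passes to the
    pointwise limit [X] there. *)
Lemma near_node_lim (x : nat * nat -> R) (X : R -> R) (s l : R) : 0 <= s ->
  (forall t, x (k, node k t) @[k --> U] --> X t) ->
  x @ near_node s --> l -> X s = l /\ {for s, continuous X}.
Proof.
move=> s0 xX xl.
have key e : 0 < e -> exists2 d, 0 < d & forall t, `|t - s| < d -> `|l - X t| <= e.
  move=> e0; have [d d0 hd] := near_node_sample (cvg_near_le xl e0) s0.
  exists d => // t ts; have h : (`|l - x (k, node k t)|) @[k --> U] --> `|l - X t|.
    by apply: cvg_norm; apply: cvgB (xX t); exact: cvg_cst.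
  by apply: (cvgr_to_le h); exact: hd.
have e : X s = l.
  apply/eqP; rewrite eq_sym -subr_eq0 -normr_le0; apply/ler_addgt0Pr => e e0.
  by have [d d0 hd] := key e e0; rewrite add0r; apply: hd; rewrite subrr normr0.
split=> //; apply/cvgrPdist_le => eps e0; have [d d0 hd] := key eps e0.
rewrite e; near=> t; apply: hd; rewrite distrC; near: t.
exact: near_dist.
Unshelve. all: by end_near. Qed.

(** The equicontinuity argument: a Lipschitz bound independent of the mesh turns convergence at the
    single time [s] into convergence uniform over nearby nodes. *)
Lemma near_node_lip (x : nat * nat -> R) (s l C eta : R) : 0 <= s -> 0 < eta -> 0 <= C ->
  (forall k j, `|j%:R * mesh k - s| < eta -> `|x (k, j.+1) - x (k, j)| <= C * mesh k) ->
  x (k, node k s) @[k --> U] --> l ->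
  x @ near_node s --> l.
Proof.
move=> s0 eta0 C0 lip xl.
have steps k i m : `|i%:R * mesh k - s| < eta -> `|(i + m)%:R * mesh k - s| < eta ->
    `|x (k, (i + m)%N) - x (k, i)| <= C * (m%:R * mesh k).
  move=> hi; elim: m => [|m IH]; first by rewrite addn0 subrr normr0 mul0r mulr0.
  rewrite addnS => him.
  have m0 := mesh_gt0 k.
  have hm : `|(i + m)%:R * mesh k - s| < eta.
    move: him hi; rewrite -natr1 natrD !ltr_norml.
    by have : 0 <= m%:R * mesh k :> R; [rewrite mulr_ge0 // ltW|lra].
  have -> : x (k, (i + m).+1) - x (k, i) =
     (x (k, (i + m).+1) - x (k, (i + m)%N)) + (x (k, (i + m)%N) - x (k, i)) by lra.
  apply: le_trans (ler_normD _ _) _; rewrite -natr1 mulrDl mulrDr mul1r addrC.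
  by apply: lerD; [exact: IH|exact: lip].
apply/cvgrPdist_le => e e0.
(* Two nodes within [d] of [s] are at most [2 d] apart, which costs at most [e / 2]; [C + 1] keeps
   the denominator positive. *)
pose d := Num.min eta (e / (4 * (C + 1))).
have C1 : 0 < C + 1 by lra.
have d0 : 0 < d by rewrite lt_min eta0 divr_gt0 // mulr_gt0.
exists d => //; near=> k => j hj.
have hk : `|(node k s)%:R * mesh k - s| < d.
  by near: k; apply: node_near; rewrite // subrr normr0.
have xk : `|l - x (k, node k s)| <= e / 2.
  by near: k; apply: (cvg_near_le xl); rewrite divr_gt0.
have dle (y : R) : y < d -> y < eta by move=> yd; apply: lt_le_trans yd _; rewrite ge_min lexx.
have m0 := mesh_gt0 k.
have dC : C * (2 * d) <= e / 2.
  have : d <= e / (4 * (C + 1)) by rewrite ge_min lexx orbT.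
  rewrite ler_pdivlMr ?mulr_gt0 // => h.
  have : 0 <= d * C by rewrite mulr_ge0 // ltW.
  by have : 0 < d := d0; nra.
have dist : `|x (k, j) - x (k, node k s)| <= e / 2.
  apply: le_trans dC; move: hj hk; case: (leqP (node k s) j) => ij hj hk.
    have [m e1] : exists m, j = (node k s + m)%N by exists (j - node k s)%N; rewrite subnKC.
    rewrite e1; apply: le_trans (steps _ _ _ _ _) _; rewrite -?e1; try exact: dle.
    apply: ler_wpM2l => //; move: hj hk; rewrite e1 natrD !ltr_norml; lra.
  have [m e1] : exists m, node k s = (j + m)%N by exists (node k s - j)%N; rewrite subnKC // ltnW.
  rewrite distrC e1; apply: le_trans (steps _ _ _ _ _) _; rewrite -?e1; try exact: dle.
  apply: ler_wpM2l => //; move: hj hk; rewrite e1 natrD !ltr_norml; lra.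
have -> : l - x (k, j) = (l - x (k, node k s)) - (x (k, j) - x (k, node k s)) by lra.
by apply: le_trans (ler_normB _ _) _; lra.
Unshelve. all: by end_near. Qed.

(** A discrete mean value inequality: the difference quotients [y] are within [e] of [c] near [s],
    so summing the steps between two times bounds the error by [e] times their distance, and this
    survives the limit. *)
Lemma near_node_derive (x y : nat * nat -> R) (X : R -> R) (s c : R) : 0 < s ->
  (forall k j, x (k, j.+1) - x (k, j) = mesh k * y (k, j)) ->
  (forall t, x (k, node k t) @[k --> U] --> X t) ->
  y @ near_node s --> c ->
  is_derive s 1 X c.
Proof.
move=> s0 xy xX yc.
have key e : 0 < e -> exists2 d, 0 < d & forall a b, a <= b ->
    `|a - s| < d -> `|b - s| < d -> `|X b - X a - (b - a) * c| <= e * (b - a).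
  move=> e0; have [d d0 hd] := cvg_near_le yc e0.
  exists (Num.min d s) => [|a b ab]; first by rewrite lt_min d0.
  rewrite !lt_min => /andP[ad as_] /andP[bd bs].
  have a0 : 0 < a by move: as_; rewrite ltr_norml; lra.
  have b0 : 0 < b by lra.
  pose D k : R := ((node k b)%:R - (node k a)%:R) * mesh k.
  have Dl : D @ U --> b - a.
    have nl t : 0 <= t -> (node k t)%:R * mesh k @[k --> U] --> t.
      move=> t0; apply/cvgrPdist_lt => eps eps0; near=> k; rewrite distrC; near: k.
      by apply: node_near; rewrite // subrr normr0.
    have -> : D = (fun k => (node k b)%:R * mesh k - (node k a)%:R * mesh k).
      by apply/funext => k; rewrite /D mulrBl.
    by apply: cvgB; apply: nl; exact: ltW.
  have h1 : (x (k, node k b) - x (k, node k a) - D k * c) @[k --> U]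
      --> X b - X a - (b - a) * c.
    by apply: cvgB; [exact: cvgB|apply: cvgMr_tmp].
  have h2 : e * D k @[k --> U] --> e * (b - a) by exact: cvgMl_tmp.
  apply: (ler_cvg_to (cvg_norm h1) h2); near=> k.
  have m0 := mesh_gt0 k.
  have ka : `|(node k a)%:R * mesh k - s| < d by near: k; apply: node_near => //; exact: ltW.
  have kb : `|(node k b)%:R * mesh k - s| < d by near: k; apply: node_near => //; exact: ltW.
  have hy j : `|j%:R * mesh k - s| < d -> `|c - y (k, j)| <= e by move: j; near: k.
  have [m em] : exists m, node k b = (node k a + m)%N.
    by exists (node k b - node k a)%N; rewrite subnKC // le_node.
  rewrite /D em natrD [_ + m%:R]addrC addrK; rewrite em in kb.
  elim: m kb {em} => [|m IH] kb; first by rewrite addn0 !mul0r subrr subr0 normr0 mulr0.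
  have kb' : `|(node k a + m)%:R * mesh k - s| < d.
    move: kb ka; rewrite addnS -natr1 natrD !ltr_norml.
    by have : 0 <= m%:R * mesh k :> R; [rewrite mulr_ge0 // ltW|lra].
  have {}IH := IH kb'; have := hy _ kb'; have := xy k (node k a + m)%N.
  rewrite addnS -natr1.
  move: (x (k, (node k a + m).+1)) (x (k, (node k a + m)%N)) (x (k, node k a)) IH.
  move=> x1 x2 x3 IH ex hyk.
  have -> : x1 - x3 - (m%:R + 1) * mesh k * c =
     (x2 - x3 - m%:R * mesh k * c) - mesh k * (c - y (k, (node k a + m)%N)) by lra.
  apply: le_trans (ler_normB _ _) _; rewrite normrM (gtr0_norm m0).
  by have := ler_wpM2l (ltW m0) hyk; lra.
apply: is_derive_littleo => e e0; have [d d0 hd] := key e e0.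
near=> t; rewrite /GRing.scale /= mulr1.
have td : `|t| < d.
  near: t; apply: filterS (near_dist (0:R) d0) => z.
  by rewrite sub0r normrN.
have [t0|t0] := leP 0 t.
  have := hd s (s + t); rewrite subrr normr0 [s + t - s]addrC addKr ger0_norm //.
  by rewrite lerDl => h; apply: h => //; rewrite -(ger0_norm t0).
have := hd (s + t) s; rewrite subrr normr0 [s + t - s]addrC addKr ltr0_norm //.
rewrite opprD addrA subrr add0r gerDl => h.
rewrite -normrN; have -> : - (X (s + t) - X s - t * c) = X s - X (s + t) - - t * c by lra.
by apply: h; [exact: ltW| |]; rewrite // -ltr0_norm.
Unshelve. all: by end_near. Qed.
End sampling.

#[local] Existing Instance near_node_filter.

(** * The limit profile *)

Section profile.
Variables (R : realType) (n L : nat) (B : 'rV[R]_L -> 'rV[R]_L) (M : R).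
Hypotheses (n0 : (0 < n)%N) (L0 : (0 < L)%N).
Hypothesis B0M : forall u i, 0 <= B u ord0 i <= M.
Hypothesis B_cont : continuous B.

Let M0 : 0 <= M.
Proof. by have /andP[M0 /(le_trans M0)] := B0M 0 (Ordinal L0). Qed.

Let nR : 1 <= n%:R :> R. Proof. by rewrite ler1n. Qed.

Definition drift (u g : 'rV[R]_L) (s : R) (c : 'I_L) : R :=
  - (B u ord0 c + n%:R * g ord0 c) / (2 * s).

(* Limits along the ultrafilter exist without extracting subsequences, and
   equicontinuity makes them locally uniform. *)
Lemma radial_profile : exists P G : R -> 'rV[R]_L,
  [/\ simplex L (P 0),
      forall (s t : R) c, s <= t -> P s ord0 c - (t - s) * M <= P t ord0 c <= P s ord0 c,
      forall c, G 0 ord0 c = - B (P 0) ord0 c / n%:R /\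
        forall s : R, 0 <= s -> {for s, continuous (fun t => G t ord0 c)},
      forall (s : R) c, 0 < s -> is_derive s 1 (fun t => P t ord0 c) (G s ord0 c / 2) /\
        is_derive s 1 (fun t => G t ord0 c) (drift (P s) (G s) s c)
    & (forall s c, 0 <= P s ord0 c) \/ exists2 T, 0 <= T & P T = 0].
Proof.
have [U [UU oU]] := ultraFilterLemma (@eventually_filter).
(* Taking [(k + 1)^2] steps of length [1 / (k + 1)] gives the horizon [k + 1], which tends to
   infinity. *)
have /choice[aj haj] : forall k, exists aj : 'rV[R]_L * nat,
    [/\ simplex L aj.1, (aj.2 <= k.+1 ^ 2)%N,
      forall i, - (mesh R k * M) <= (euler n B (mesh R k) aj.1 aj.2).1 ord0 i &
      aj.2 = (k.+1 ^ 2)%N \/ forall i, (euler n B (mesh R k) aj.1 aj.2).1 ord0 i <= 0].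
  move=> k; have [a [j [h1 h2 h3 h4]]] :=
    discrete_shooting n0 B0M B_cont (k.+1 ^ 2) L0 (ltW (mesh_gt0 R k)).
  by exists (a, j).
pose a k := (aj k).1; pose jx k := (aj k).2.
pose u (p : nat * nat) := (euler n B (mesh R p.1) (a p.1) p.2).1.
pose g (p : nat * nat) := (euler n B (mesh R p.1) (a p.1) p.2).2.
have m0 k : 0 <= mesh R k by exact/ltW/mesh_gt0.
have ustep k j c : u (k, j) ord0 c - mesh R k * M <= u (k, j.+1) ord0 c <= u (k, j) ord0 c.
  exact: euler_step_bounds.
have gb k j c : - M <= g (k, j) ord0 c <= 0 by exact: euler_slope_bounds.
have udec k i j c : (i <= j)%N -> u (k, j) ord0 c <= u (k, i) ord0 c.
  by move=> ij; exact: (euler_nincr n0 B0M).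
have ulow k i m c : u (k, i) ord0 c - m%:R * mesh R k * M <= u (k, (i + m)%N) ord0 c.
  elim: m => [|m IH]; first by rewrite addn0 !mul0r subr0.
  rewrite addnS; have /andP[h _] := ustep k (i + m)%N c.
  by apply: le_trans h; rewrite -natr1; lra.
have uS k c : u (k, 0%N) ord0 c = a k ord0 c by [].
have ulim (sc : R * 'I_L) : exists l : R, u (k, node k sc.1) ord0 sc.2 @[k --> U] --> l.
  case: sc => s c /=.
  have [|l _ hl] := ultra_cvg_ex (x := fun k => u (k, node k s) ord0 c)
     (a := - (`|s| * M)) (b := 1) UU; last by exists l.
  apply: filterE => k; have [aS _ _ _] := haj k; apply/andP; split; last first.
    by apply: le_trans (udec k 0%N _ c (leq0n _)) _; rewrite uS (simplex_le1 _ aS).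
  have := ulow k 0%N (node k s) c; rewrite add0n uS; apply: le_trans.
  have a0 : 0 <= a k ord0 c by case: aS.
  have : (node k s)%:R * mesh R k <= `|s|.
    have [s0|s0] := leP 0 s; last by rewrite node_nonpos ?mul0r // ltW.
    by have /andP[h _] := node_bounds k s0; rewrite ger0_norm.
  by move=> h; have := ler_wpM2r M0 h; lra.
have glim (sc : R * 'I_L) : exists l : R, g (k, node k sc.1) ord0 sc.2 @[k --> U] --> l.
  case: sc => s c /=.
  have [|l _ hl] := ultra_cvg_ex (x := fun k => g (k, node k s) ord0 c)
     (a := - M) (b := 0) UU; last by exists l.
  exact: filterE.
have /choice[P' hP'] := ulim; have /choice[G' hG'] := glim.
pose P s := \row_c P' (s, c); pose G s := \row_c G' (s, c).
have hP s c : u (k, node k s) ord0 c @[k --> U] --> P s ord0 c.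
  by rewrite mxE; exact: (hP' (s, c)).
have hG s c : g (k, node k s) ord0 c @[k --> U] --> G s ord0 c.
  by rewrite mxE; exact: (hG' (s, c)).
have uW (s : R) c : 0 <= s -> (fun p => u p ord0 c) @ near_node U s --> P s ord0 c.
  move=> s0; apply: (near_node_lip UU oU (C := M) (eta := 1)) => // k j _.
  by have := ustep k j c; rewrite ler_norml; have := m0 k; nra.
have BW (s : R) c : 0 <= s -> (fun p => B (u p) ord0 c) @ near_node U s --> B (P s) ord0 c.
  move=> s0; have uv : u @ near_node U s --> P s by apply: cvg_row => c'; exact: uW.
  have Bu := @cvg_comp _ _ _ u B _ _ _ uv (@B_cont (P s)).
  exact: (@cvg_comp _ _ _ (fun p => B (u p)) (fun v : 'rV[R]_L => v ord0 c) _ _ _ Bu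
    (@coord_continuous _ _ _ ord0 c (B (P s)))).
have gW0 c : (fun p => g p ord0 c) @ near_node U (0 : R) --> - B (P 0) ord0 c / n%:R.
  apply/cvgrPdist_le => e e0.
  have [d d0 hd] := cvg_near_le (BW 0 c (lexx 0)) e0.
  exists d => //; near=> k => j hj.
  have hk i : `|i%:R * mesh R k - 0| < d -> `|B (u (k, i)) ord0 c - B (P 0) ord0 c| <= e.
    by move=> hi; rewrite distrC; move: i hi; near: k.
  have := @euler_slope_near R n L B n0 (mesh R k) (a k) j c (B (P 0) ord0 c) e.
  move=> /(_ (hk 0%N _)) h.
  have {}h : `|n%:R * g (k, j) ord0 c + B (P 0) ord0 c| <= e.
    apply: h => [|i ij]; first by rewrite mul0r subrr normr0.
    apply: hk; apply: le_lt_trans hj; rewrite !subr0 !ger0_norm ?mulr_ge0 //.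
    by rewrite ler_wpM2r // ler_nat ltnW.
  have nN : n%:R != 0 :> R by rewrite gt_eqF // (lt_le_trans ltr01).
  have -> : - B (P 0) ord0 c / n%:R - g (k, j) ord0 c =
      - ((n%:R * g (k, j) ord0 c + B (P 0) ord0 c) / n%:R) by field.
  rewrite normrN normrM normfV [X in _ / X]ger0_norm // ler_pdivrMr ?(lt_le_trans ltr01) //.
  by apply: le_trans h _; rewrite ler_peMr // ltW.
have gstep k j c : g (k, j.+1) ord0 c - g (k, j) ord0 c =
    - step_weight R n j * (g (k, j) ord0 c + B (u (k, j)) ord0 c / n%:R).
  by rewrite /g /u /= !mxE; lra.
(* For nodes beyond [s / 2] the weight is at most [n h / s], which makes the slopes equi-Lipschitz
   near [s]. *)
have gWs (s : R) c : 0 < s -> (fun p => g p ord0 c) @ near_node U s --> G s ord0 c.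
  move=> s0; apply: (near_node_lip UU oU (C := n%:R * M / s) (eta := s / 2)) => //.
  - exact: ltW.
  - by rewrite divr_gt0.
  - by rewrite divr_ge0 ?mulr_ge0 // ltW.
  move=> k j hj; rewrite gstep normrM normrN.
  have /andP[w0 _] := step_weight_bounds R n0 j.
  rewrite (ger0_norm w0).
  have h1 : `|g (k, j) ord0 c + B (u (k, j)) ord0 c / n%:R| <= M.
    have /andP[g1 g2] := gb k j c; have /andP[b1 b2] := B0M (u (k, j)) c.
    have b3 : 0 <= B (u (k, j)) ord0 c / n%:R by rewrite divr_ge0.
    have b4 : B (u (k, j)) ord0 c / n%:R <= M.
      rewrite ler_pdivrMr ?(lt_le_trans ltr01) //; apply: le_trans b2 _.
      by rewrite ler_peMr.
    by rewrite ler_norml; lra.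
  have h2 : step_weight R n j <= n%:R * mesh R k / s.
    rewrite /step_weight ler_pdivrMr ?ltr0n ?addn_gt0 ?n0 ?orbT //.
    have -> (y : R) : n%:R * mesh R k / s * y = n%:R * (mesh R k * y / s) by ring.
    rewrite ler_peMr // ler_pdivlMr // mul1r.
    rewrite natrD -muln2 natrM.
    move: hj; rewrite ltr_norml => /andP[hj _].
    have : 0 <= mesh R k * n%:R by rewrite mulr_ge0.
    by lra.
  apply: le_trans (ler_pM w0 (normr_ge0 _) h2 h1) _.
  by rewrite le_eqVlt; apply/orP; left; apply/eqP; lra.
(* The difference quotient of [g]; the term [n h] in the denominator comes from the implicit
   treatment and vanishes in the limit. *)
pose w c (p : nat * nat) := - (n%:R / (2 * (p.2%:R * mesh R p.1) + n%:R * mesh R p.1)) *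
   (g p ord0 c + B (u p) ord0 c / n%:R).
have wW (s : R) c : 0 < s -> w c @ near_node U s --> drift (P s) (G s) s c.
  move=> s0; have -> : drift (P s) (G s) s c =
      - (n%:R / (2 * s + n%:R * 0)) * (G s ord0 c + B (P s) ord0 c / n%:R).
    rewrite /drift mulr0 addr0; field.
    by rewrite (gt_eqF s0) gt_eqF // (lt_le_trans ltr01).
  have h1 : (fun p => g p ord0 c + B (u p) ord0 c / n%:R) @ near_node U s -->
      G s ord0 c + B (P s) ord0 c / n%:R.
    by apply: cvgD; [exact: gWs|apply: cvgMr_tmp; apply: BW; exact: ltW].
  have h2 : (fun p => 2 * (p.2%:R * mesh R p.1) + n%:R * mesh R p.1) @ near_node U s -->
      2 * s + n%:R * 0.
    apply: cvgD; apply: cvgMl_tmp; first by apply: near_node_cvg => //; exact: ltW.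
    exact: near_node_mesh.
  have d0 : 2 * s + n%:R * 0 != 0 by rewrite mulr0 addr0 mulf_neq0 // gt_eqF.
  have h3 : (fun p => n%:R / (2 * (p.2%:R * mesh R p.1) + n%:R * mesh R p.1)) @
      near_node U s --> n%:R / (2 * s + n%:R * 0).
    by apply: cvgMl_tmp; exact: cvgV.
  have h4 : (fun p => - (n%:R / (2 * (p.2%:R * mesh R p.1) + n%:R * mesh R p.1))) @
      near_node U s --> - (n%:R / (2 * s + n%:R * 0)).
    exact: cvgN.
  exact: (cvgM h4 h1).
have gw k j c : g (k, j.+1) ord0 c - g (k, j) ord0 c = mesh R k * w c (k, j).
  rewrite gstep /w /= /step_weight natrD -muln2 natrM; field.
  have np : 0 < n%:R :> R by apply: lt_le_trans nR.
  have j0 : 0 <= j%:R * mesh R k by rewrite mulr_ge0.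
  have nm : 0 < n%:R * mesh R k by rewrite mulr_gt0 // mesh_gt0.
  have jR : 0 <= j%:R :> R by [].
  by rewrite !gt_eqF //; lra.
exists P, G; split.
- split=> [i|].
    apply: (cvgr_to_ge (hP 0 i)); apply: filterE => k.
    by rewrite node_nonpos // uS; have [[a0 _] _ _ _] := haj k; exact: a0.
  have h : (\sum_i u (k, node k (0 : R)) ord0 i : R) @[k --> U] --> (\sum_i P 0 ord0 i : R).
    by apply: (cvg_sumr (f := fun i k => u (k, node k (0 : R)) ord0 i)) => i; exact: hP.
  apply: (cvg_const_eq h); apply: filterE => k; rewrite node_nonpos //.
  by have [[_ <-] _ _ _] := haj k.
- move=> s t c st; apply/andP; split; last first.
    by apply: (ler_cvg_to (hP t c) (hP s c)); apply: filterE => k; apply/udec/le_node.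
  have h : (u (k, node k s) ord0 c - (t - s + mesh R k) * M) @[k --> U] -->
      P s ord0 c - (t - s + 0) * M.
    apply: cvgB; first exact: hP.
    by apply: cvgMr_tmp; apply: cvgD; [exact: cvg_cst|exact: cvg_mesh].
  rewrite addr0 in h.
  apply: (ler_cvg_to h (hP t c)); apply: filterE => k.
  have [m em] : exists m, node k t = (node k s + m)%N.
    by exists (node k t - node k s)%N; rewrite subnKC // le_node.
  have := ulow k (node k s) m c; rewrite -em; apply: le_trans.
  have := node_diff k st; rewrite em natrD [_ + m%:R]addrC addrK => hm.
  by have := ler_wpM2r M0 hm; lra.
- move=> c; have [e h0] := near_node_lim UU oU (lexx 0) (fun t => hG t c) (gW0 c).
  split=> // s; rewrite le_eqVlt => /orP[/eqP <- //|s0].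
  by have [] := near_node_lim UU oU (ltW s0) (fun t => hG t c) (gWs s c s0).
- move=> s c s0; split.
    apply: (near_node_derive UU oU s0 (x := fun p => u p ord0 c)
      (y := fun p => g (p.1, p.2.+1) ord0 c / 2)).
    + move=> k j /=.
      have -> : u (k, j.+1) ord0 c = u (k, j) ord0 c + mesh R k / 2 * g (k, j.+1) ord0 c.
        by rewrite /u /= [LHS]mxE; congr (_ + _); exact: mxE.
      by lra.
    + by move=> t; exact: hP.
    + apply: cvgMr_tmp.
      have -> : (fun p : nat * nat => g (p.1, p.2.+1) ord0 c) =
          (fun p => g p ord0 c + mesh R p.1 * w c p).
        by apply/funext => -[k j] /=; rewrite -gw; lra.
      rewrite -[X in _ --> X]addr0 -(mul0r (drift (P s) (G s) s c)).
      apply: cvgD; first exact: gWs.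
      by apply: cvgM; [exact: near_node_mesh|exact: wW].
  apply: (near_node_derive UU oU s0 (x := fun p => g p ord0 c) (y := w c)).
  + by move=> k j; exact: gw.
  + by move=> t; exact: hG.
  + exact: wW.
(* Stopping times. If they are bounded along [U], their limit is a zero of [P]; if not, each fixed
   time precedes [tau k] for almost all [k], and monotonicity makes [P] nonnegative. *)
pose tau k := (jx k)%:R * mesh R k.
have [[T0 hT0]|noT] := pselect (exists T0, \forall k \near U, tau k <= T0).
  right; have [|T /andP[T1 _] hT] := ultra_cvg_ex (x := tau) (a := 0) (b := T0) UU.
    by apply: filterS hT0 => k ->; rewrite mulr_ge0.
  exists T => //; apply/rowP => c; rewrite [RHS]mxE.
  have h : u (k, jx k) ord0 c @[k --> U] --> P T ord0 c.
    apply/cvgrPdist_le => e e0; have [d d0 hd] := cvg_near_le (uW T c T1) e0.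
    near=> k; have : `|tau k - T| < d.
      by rewrite distrC; near: k; exact: cvg_near_lt hT _ d0.
    rewrite /tau; move: (jx k); near: k.
    exact: hd.
  have lim0 : - (mesh R k * M) @[k --> U] --> (0 : R).
    rewrite -[X in _ --> X]oppr0 -(mul0r M).
    by apply: cvgN; apply: cvgMr_tmp; exact: cvg_mesh.
  apply/eqP; rewrite eq_le (ler_cvg_to lim0 h) ?andbT; last first.
    by apply: filterE => k; have [_ _ h1 _] := haj k.
  apply: (cvgr_to_le h); near=> k; have [_ _ _ h2] := haj k.
  case: h2 => [h2|]; last exact.
  (* A run that reaches the horizon has [tau k = k + 1], which eventually exceeds [T0]. *)
  have : tau k <= T0 by near: k.
  suff : T0 < tau k by rewrite ltNge => /negP.
  rewrite /tau /jx h2 /mesh natrX expr2 mulfK ?pnatr_eq0 //.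
  near: k; apply: oU; near=> k.
  apply: (@lt_trans _ _ k%:R); last by rewrite ltr_nat.
  by near: k; exact: nbhs_infty_gtr.
left=> s c.
have [h|h] := in_ultra_setVsetC (fun k => tau k <= `|s| + 1) UU.
  by exfalso; apply: noT; exists (`|s| + 1).
have lim0 : - (mesh R k * M) @[k --> U] --> (0 : R).
  rewrite -[X in _ --> X]oppr0 -(mul0r M).
  by apply: cvgN; apply: cvgMr_tmp; exact: cvg_mesh.
apply: (ler_cvg_to lim0 (hP s c)); apply: filterS h => k /negP; rewrite -ltNge => hk.
have [_ _ h1 _] := haj k; apply: le_trans (h1 c) _; apply: udec.
have [s0|s0] := leP 0 s; last by rewrite node_nonpos // ltW.
have /andP[h2 _] := node_bounds k s0.
rewrite -(ler_nat R) -(ler_pM2r (mesh_gt0 R k)); apply: le_trans h2 _.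
by apply: le_trans (ltW hk); rewrite ger0_norm //; lra.
Unshelve. all: by end_near. Qed.
End profile.

(** * Radial functions on the Euclidean space *)

Lemma is_derive_line {R : realType} {V : normedModType R} (f : V -> R) (x v : V) (d : R) :
  is_derive (0 : R) (1 : R) (fun t => f (x + t *: v)) d -> is_derive x v f d.
Proof.
have e : (fun h : R => h^-1 *: (((fun t => f (x + t *: v)) \o shift 0) (h *: 1) - f (x + 0 *: v)))
   = (fun h => h^-1 *: ((f \o shift x) (h *: v) - f x)).
  apply/funext => h; rewrite /= scale0r !addr0 [_ *: 1]/GRing.scale /= mulr1.
  by rewrite [x + _]addrC.
move=> [h1 h2]; split; first by rewrite /derivable -e.
by rewrite -h2 /derive -e.
Qed.

Section sqn.
Variables (R : realType) (n : nat).

Definition sqn (x : 'rV[R]_n) : R := \sum_(i < n) x ord0 i ^+ 2.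

Lemma sqn_ge0 x : 0 <= sqn x.
Proof. by apply: sumr_ge0 => i _; rewrite sqr_ge0. Qed.

Lemma sqn_continuous : continuous sqn.
Proof.
move=> x; apply: (@cvg_sumr _ _ _ (nbhs x) _ (fun i y => y ord0 i ^+ 2)) => i.
have c := @coord_continuous R 1 n ord0 i x.
by rewrite expr2; apply: cvgM.
Qed.

Lemma sqn_line x (j : 'I_n) t :
  sqn (x + t *: delta_mx ord0 j) = sqn x + 2 * t * x ord0 j + t ^+ 2.
Proof.
rewrite /sqn (bigD1 j) //= [in RHS](bigD1 j) //= !mxE !eqxx mulr1.
rewrite (eq_bigr (fun i => x ord0 i ^+ 2)); last first.
  by move=> i /negbTE ij; rewrite !mxE eqxx ij mulr0 addr0.
by ring.
Qed.

Lemma sqr_coord_le (x : 'rV[R]_n) i : x ord0 i ^+ 2 <= sqn x.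
Proof.
by rewrite /sqn (bigD1 i) //= lerDl; apply: sumr_ge0 => k _; rewrite sqr_ge0.
Qed.

Lemma mul_coord_le (x : 'rV[R]_n) i j : `|x ord0 i * x ord0 j| <= sqn x.
Proof.
have h1 := sqr_coord_le x i; have h2 := sqr_coord_le x j.
rewrite ler_norml; move: (x ord0 i) (x ord0 j) h1 h2 => a b h1 h2.
by have := sqr_ge0 (a - b); have := sqr_ge0 (a + b); nra.
Qed.

Lemma sqn_eq0 x : sqn x = 0 -> x = 0.
Proof.
move=> x0; apply/rowP => i; rewrite mxE; apply/eqP; rewrite -sqrf_eq0.
by rewrite eq_le sqr_ge0 andbT -x0 sqr_coord_le.
Qed.
End sqn.

Section radial.
Variables (R : realType) (n : nat) (p g b : R -> R) (M : R).
Hypothesis n0 : (0 < n)%N.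
Hypothesis p_lip : forall s t, s <= t -> p s - (t - s) * M <= p t <= p s.
Hypothesis g0 : g 0 = - b 0 / n%:R.
Hypothesis g_cont : forall s : R, 0 <= s -> {for s, continuous g}.
Hypothesis b_cont : forall s : R, 0 <= s -> {for s, continuous b}.
Hypothesis p_der : forall s : R, 0 < s -> is_derive s 1 p (g s / 2).
Hypothesis g_der : forall s : R, 0 < s -> is_derive s 1 g (- (b s + n%:R * g s) / (2 * s)).

Local Notation e_ j := (delta_mx ord0 j).

Definition radial_fst (i : 'I_n) (x : 'rV[R]_n) : R := x ord0 i * g (sqn x).

(* At [x = 0] the division by [sqn x = 0] gives [0], which is the value of the
   second derivative there because [b 0 + n g 0 = 0]. *)
Definition radial_snd (i j : 'I_n) (x : 'rV[R]_n) : R :=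
  (i == j)%:R * g (sqn x) -
  x ord0 i * x ord0 j / sqn x * (b (sqn x) + n%:R * g (sqn x)).

Lemma radial_continuous (h : R -> R) (x : 'rV[R]_n) :
  (forall s : R, 0 <= s -> {for s, continuous h}) -> {for x, continuous (fun y => h (sqn y))}.
Proof.
move=> hc; exact: (@cvg_comp _ _ _ (@sqn R n) h _ _ _ (@sqn_continuous R n x) (hc _ (sqn_ge0 x))).
Qed.

Lemma p_cont s : {for s, continuous p}.
Proof.
have M0 : 0 <= M.
  by have /andP[h1 h2] := p_lip (ler01); have := le_trans h1 h2; lra.
apply/cvgrPdist_le => e e0; near=> t.
have h : `|s - t| * M <= e.
  have h : `|s - t| <= e / (M + 1).
    by apply: ltW; near: t; apply: near_dist; rewrite divr_gt0 //; lra.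
  have M1 : 0 < M + 1 by lra.
  rewrite ler_pdivlMr // in h; apply: le_trans h.
  by rewrite mulrDr mulr1 lerDl.
apply: le_trans h; have [st|ts] := leP s t.
  by have /andP[? ?] := p_lip st; rewrite [in leRHS]ler0_norm ?subr_le0 // ler_norml; lra.
by have /andP[? ?] := p_lip (ltW ts); rewrite [in leRHS]gtr0_norm ?subr_gt0 // ler_norml; lra.
Unshelve. all: by end_near. Qed.

Lemma is_derive_sqn_line (h : R -> R) (s xj d : R) :
  is_derive s 1 h d ->
  is_derive (0 : R) 1 (fun t : R => h (s + 2 * t * xj + t ^+ 2)) (2 * xj * d).
Proof.
move=> hd; pose q := (fun t : R => s + 2 * t * xj + t ^+ 2).
have dq : is_derive (0 : R) 1 q (2 * xj).
  have -> : q = cst s + ((2 * xj) \*: id) + id ^+ 2.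
    by apply/funext => t; rewrite /q !fctE /= /GRing.scale /=; ring.
  apply: is_derive_eq; rewrite /GRing.scale /=; ring.
have hq : is_derive (q 0) 1 h d by rewrite /q mulr0 mul0r expr0n !addr0.
have := is_derive1_comp hq dq.
by rewrite mulrC.
Qed.

Lemma radial_derive1 (x : 'rV[R]_n) j :
  is_derive x (e_ j) (fun y => p (sqn y)) (radial_fst j x).
Proof.
(* At the origin [p] is not assumed differentiable; its Lipschitz bound gives a change of at most
   [M t^2] along a line, so the derivative is zero. *)
have [x0|x0] := eqVneq (sqn x) 0.
  have M0 : 0 <= M.
    by have /andP[h1 h2] := p_lip (ler01); have := le_trans h1 h2; lra.
  have x00 := sqn_eq0 x0; subst x.
  apply: is_derive_littleo => e e0; rewrite /radial_fst.
  near=> t; rewrite sqn_line x0 mxE mul0r !mulr0 !add0r subr0.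
  have := p_lip (sqr_ge0 t); rewrite subr0 => /andP[h1 h2].
  rewrite ler0_norm ?subr_le0 //.
  have h : `|t| * M <= e.
    have h : `|t| <= e / (M + 1).
      apply: ltW; rewrite -normrN -sub0r; near: t; apply: near_dist.
      by rewrite divr_gt0 //; lra.
    have M1 : 0 < M + 1 by lra.
    rewrite ler_pdivlMr // in h; apply: le_trans h.
    by rewrite mulrDr mulr1 lerDl.
  have := ler_wpM2r (normr_ge0 t) h; rewrite mulrAC -expr2 real_normK ?num_real //.
  by lra.
have s0 : 0 < sqn x by rewrite lt_def x0 sqn_ge0.
apply: is_derive_line.
have -> : (fun t => p (sqn (x + t *: e_ j))) =
    (fun t => p (sqn x + 2 * t * x ord0 j + t ^+ 2)).
  by apply/funext => t; rewrite sqn_line.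
apply: is_derive_eq (is_derive_sqn_line _ (p_der s0)) _.
by rewrite /radial_fst; lra.
Unshelve. all: by end_near. Qed.

Lemma radial_derive2 (x : 'rV[R]_n) i j :
  is_derive x (e_ j) (radial_fst i) (radial_snd i j x).
Proof.
(* At the origin continuity of [g] suffices, because of the factor [x_i]. *)
have [x0|x0] := eqVneq (sqn x) 0.
  have x00 := sqn_eq0 x0; subst x.
  apply: is_derive_littleo => e e0; rewrite /radial_fst /radial_snd x0 invr0 mulr0 mul0r subr0.
  have gc : (fun t : R => g (t ^+ 2)) @ (0 : R) --> g 0.
    have c0 : {for (0 : R) ^+ 2, continuous g} by rewrite expr0n; exact: g_cont.
    have := @cvg_comp _ _ _ (fun t : R => t ^+ 2) g _ _ _ (@exprn_continuous R 2 0) c0.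
    by rewrite expr0n.
  near=> t; rewrite sqn_line x0 !mxE eqxx /= !mulr0 mul0r !add0r subr0.
  have -> : t * (i == j)%:R * g (t ^+ 2) - t * ((i == j)%:R * g 0) =
    - (t * (i == j)%:R * (g 0 - g (t ^+ 2))) by ring.
  rewrite normrN !normrM mulrC; apply: ler_pM => //; rewrite ?mulr_ge0 //.
    by near: t; exact: (cvg_near_le gc).
  by case: (i == j); rewrite ?normr1 ?mulr1 // normr0 mulr0.
have s0 : 0 < sqn x by rewrite lt_def x0 sqn_ge0.
apply: is_derive_line.
have -> : (fun t => radial_fst i (x + t *: e_ j)) =
    (cst (x ord0 i) + ((i == j)%:R \*: id)) * (fun t => g (sqn x + 2 * t * x ord0 j + t ^+ 2)).
  apply/funext => t; rewrite /radial_fst sqn_line !fctE !mxE eqxx /= /GRing.scale /=.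
  by ring.
have gd := is_derive_sqn_line (x ord0 j) (g_der s0).
apply: is_derive_eq; rewrite !fctE /= /GRing.scale /= /radial_snd.
rewrite !mulr0 !mul0r expr0n /= !addr0.
by field.
Unshelve. all: by end_near. Qed.

Lemma radial_fst_continuous i : continuous (radial_fst i).
Proof.
move=> x; apply: (@cvgM _ _ (nbhs x) _); first exact: coord_continuous.
exact: radial_continuous.
Qed.

(** At the origin [x_i x_j / |x|^2] has no limit but is bounded by [1], while its factor [b + n g]
    tends to zero by the choice of [g 0]. *)
Lemma radial_snd_continuous i j : continuous (radial_snd i j).
Proof.
move=> x; have gx := radial_continuous (x := x) g_cont.
have kc (s : R) : 0 <= s -> {for s, continuous (fun t => b t + n%:R * g t)}.
  move=> s0; apply: (@cvgD _ _ _ (nbhs s) _); first exact: b_cont.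
  by apply: (@cvgMl_tmp _ _ (nbhs s) _); exact: g_cont.
have kx := radial_continuous (x := x) kc.
apply: (@cvgB _ _ _ (nbhs x) _); first exact: (@cvgMl_tmp _ _ (nbhs x) _).
have [x0|x0] := eqVneq (sqn x) 0.
  rewrite x0 invr0 mulr0 mul0r; apply/cvgrPdist_le => e e0.
  have k0 : b (sqn x) + n%:R * g (sqn x) = 0.
    by rewrite x0 g0; field; rewrite pnatr_eq0 -lt0n.
  have ky := cvg_near_le kx e0; rewrite k0 in ky; apply: (@filterS _ (nbhs x) _ _ _ _ (ky _)) => y.
  rewrite !sub0r !normrN => hy; rewrite normrM; apply: le_trans hy.
  rewrite -[leRHS]mul1r; apply: ler_wpM2r => //.
  rewrite normrM normfV [X in _ / X]ger0_norm ?sqn_ge0 //.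
  have [->|y0] := eqVneq (sqn y) 0; first by rewrite invr0 mulr0 ler01.
  by rewrite ler_pdivrMr ?lt_def ?y0 ?sqn_ge0 // mul1r mul_coord_le.
apply: (@cvgM _ _ (nbhs x) _); last exact: kx.
apply: (@cvgM _ _ (nbhs x) _).
  by apply: (@cvgM _ _ (nbhs x) _); exact: coord_continuous.
by apply: (@cvgV _ _ (nbhs x) _) => //; exact: sqn_continuous.
Qed.

Lemma pderive_radial j : pderive j (fun y : 'rV[R]_n => p (sqn y)) = radial_fst j.
Proof. by apply/funext => x; have [_ h] := radial_derive1 x j; exact: h. Qed.

Lemma pderive_radial_fst i j : pderive j (radial_fst i) = radial_snd i j.
Proof. by apply/funext => x; have [_ h] := radial_derive2 x i j; exact: h. Qed.

Lemma radial_C2 (V : set 'rV[R]_n) : C_k 2 V (fun y => p (sqn y)).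
Proof.
split=> [x _|i]; first by apply: radial_continuous => s _; exact: p_cont.
split=> [x _|]; first by have [] := radial_derive1 x i.
rewrite pderive_radial; split=> [x _|j]; first exact: radial_fst_continuous.
split=> [x _|]; first by have [] := radial_derive2 x i j.
by rewrite pderive_radial_fst; split=> // x _; exact: radial_snd_continuous.
Qed.

(** Away from the origin the terms [x_i^2 / |x|^2] add up to [1], so the trace is [n g - (b + n g)];
    at the origin it is [n g 0 = - b 0]. *)
Lemma radial_laplacian (x : 'rV[R]_n) : - laplacian (fun y => p (sqn y)) x = b (sqn x).
Proof.
rewrite /laplacian; under eq_bigr do rewrite pderive_radial pderive_radial_fst.
rewrite /radial_snd big_split /= sumrN.
under eq_bigr do rewrite eqxx mul1r.
rewrite sumr_const card_ord.
set K := b _ + _.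
have -> : \sum_(i < n) x ord0 i * x ord0 i / sqn x * K = sqn x * (K / sqn x).
  rewrite [X in _ = X * _]/sqn mulr_suml; apply: eq_bigr => i _.
  by rewrite expr2; ring.
have [x0|x0] := eqVneq (sqn x) 0.
  rewrite x0 g0 mul0r subr0 -mulr_natl; field; by rewrite pnatr_eq0 -lt0n.
by rewrite -mulr_natl /K; field.
Qed.
End radial.

(** * Positivity and decay of the profile *)

Lemma coord_le_norm {R : realType} {n : nat} (v : 'rV[R]_n) i : `|v ord0 i| <= `|v|.
Proof.
by rewrite [leRHS]/Num.norm /= mx_normrE; apply/bigmax_geP; right; exists (ord0, i).
Qed.

Lemma row_norm_lt {R : realType} {n : nat} (v : 'rV[R]_n) (e : R) : 0 < e ->
  (forall i, `|v ord0 i| < e) -> `|v| < e.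
Proof.
move=> e0 h; rewrite [ltLHS]/Num.norm /= mx_normrE; apply/bigmax_ltP; split=> // -[i j] _ /=.
by rewrite ord1.
Qed.

Lemma near_row {R : realType} {n : nat} (l : 'rV[R]_n) (P : 'rV[R]_n -> Prop) :
  (\forall v \near l, P v) ->
  exists2 d : R, 0 < d & forall v : 'rV[R]_n, (forall i, `|l ord0 i - v ord0 i| < d) -> P v.
Proof.
move=> /nbhs_ballP[d d0 hd]; exists d => // v hv; apply: hd; split=> // i j.
by rewrite ord1; exact: hv.
Qed.

(** * Bounded continuous extension of the nonlinearity *)

Section clip.
Variables (R : realType) (L : nat).

Definition clip (u : 'rV[R]_L) : 'rV[R]_L :=
  \row_i Num.min 1 (Num.max 0 (u ord0 i)).

Lemma clip_bounds u i : 0 <= clip u ord0 i <= 1.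
Proof. by rewrite mxE ge_min lexx le_min ler01 le_max lexx. Qed.

Lemma clip_id (u : 'rV[R]_L) : (forall i, 0 <= u ord0 i <= 1) -> clip u = u.
Proof.
move=> h; apply/rowP => i; rewrite mxE; have /andP[h1 h2] := h i.
by rewrite (max_idPr h1) (min_idPr h2).
Qed.

Lemma clip_continuous : continuous clip.
Proof.
move=> u; apply: (@cvg_row R _ L (nbhs u) clip (clip u) _) => i; rewrite mxE.
have -> : (fun v => clip v ord0 i) =
    ((fun=> 1) \min ((fun=> 0) \max (fun v : 'rV[R]_L => v ord0 i))).
  by apply/funext => v; rewrite mxE.
apply: (@continuous_min _ _ _ _ u); first exact: (@cvg_cst _ _ _ (nbhs u) _).
apply: (@continuous_max _ _ _ _ u); first exact: (@cvg_cst _ _ _ (nbhs u) _).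
exact: coord_continuous.
Qed.

Variable F : 'rV[R]_L -> 'rV[R]_L.
Hypothesis F_range : forall u, orthant L u -> orthant L (F u).
Hypothesis F_cont : {within orthant L, continuous F}.

Lemma orthant_clip u : orthant L (clip u).
Proof. by move=> i; have /andP[] := clip_bounds u i. Qed.

Lemma clipped_continuous : continuous (fun u => F (clip u)).
Proof.
move=> u A FA; have /subspace_continuousP/(_ _ (orthant_clip u) _ FA) := F_cont.
move=> W; apply: (@filterS _ (nbhs u) _ _ _ _ (@clip_continuous u _ W)) => v /=.
by apply; exact: orthant_clip.
Qed.

Lemma clipped_bounded : exists M, forall u i, 0 <= F (clip u) ord0 i <= M.
Proof.
have K : compact [set v : 'rV[R]_L | forall i, v ord0 i \in `[(0 : R), (1 : R)]].
  by apply: (@rV_compact _ _ (fun=> `[(0 : R), (1 : R)]%classic)) => _; exact: segment_compact.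
have [N [_ /(_ (N + 1))]] := compact_bounded
  (continuous_compact (continuous_subspaceT clipped_continuous) K).
rewrite ltrDl ltr01 => /(_ isT) h; exists (N + 1) => u i.
have Fu := F_range (orthant_clip u); rewrite Fu /=.
have : `|F (clip u)| <= N + 1.
  apply: h; exists (clip u); last by rewrite clip_id // => j; exact: clip_bounds.
  by move=> j /=; rewrite in_itv /=; exact: clip_bounds.
by apply: le_trans; apply: le_trans (coord_le_norm _ i); exact: ler_norm.
Qed.
End clip.

Lemma perm_initial_segment (L : nat) (A : {set 'I_L}) :
  exists s : 'S_L, forall j : 'I_L, (s j \in A) = (j < #|A|)%N.
Proof.
pose t := enum A ++ enum (~: A).
have ts : size t = L by rewrite size_cat -!cardE cardsC card_ord.
have tu : uniq t.
  rewrite cat_uniq !enum_uniq /= andbT; apply/hasPn => x.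
  by rewrite !mem_enum inE.
pose f (j : 'I_L) := nth j t j.
have fI : injective f.
  move=> i j; rewrite /f (set_nth_default i j) ?ts // => /eqP.
  by rewrite nth_uniq ?ts // => /eqP/val_inj.
exists (perm fI) => j; rewrite permE /f nth_cat -cardE.
case: ltnP => jA; first by rewrite -mem_enum mem_nth // -cardE.
have : nth j (enum (~: A)) (j - #|A|) \in enum (~: A).
  apply: mem_nth; rewrite -cardE -(ltn_add2r #|A|) subnK //.
  by rewrite addnC cardsC card_ord.
by rewrite mem_enum inE => /negbTE.
Qed.

(** Nondegeneracy for a permutation that lists the support of [u] first; a positive sum has a
    positive term. *)
Lemma nondegenerate_source {R : realType} {L : nat} (F : 'rV[R]_L -> 'rV[R]_L) u :
  nondegenerate_map F -> orthant L u ->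
  (exists i, u ord0 i = 0) -> (exists i, 0 < u ord0 i) ->
  exists2 i, u ord0 i = 0 & 0 < F u ord0 i.
Proof.
move=> nd u0 [i ui] [j uj]; pose A : {set 'I_L} := finset (fun i => 0 < u ord0 i).
have [s sA] := perm_initial_segment A.
have AL : (1 <= #|A| < L)%N.
  rewrite card_gt0; apply/andP; split; first by apply/set0Pn; exists j; rewrite inE.
  rewrite -[X in (_ < X)%N]card_ord -cardsT; apply: proper_card.
  by rewrite properT; apply/eqP => /setP/(_ i); rewrite !inE ui ltxx.
have := nd s _ AL u u0; apply: contraPP => no.
have h1 (k : 'I_L) : (k < #|A|)%N -> 0 < u ord0 (s k) by rewrite -sA inE.
have h2 (k : 'I_L) : (#|A| <= k)%N -> u ord0 (s k) = 0.
  rewrite leqNgt -sA inE -leNgt => h; apply/eqP; rewrite eq_le h.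
  exact: u0.
move=> /(_ h1 h2); rewrite ltNge => /negP; apply; apply: sumr_le0 => k hk.
rewrite leNgt; apply/negP => Fk; apply: no; exists (s k) => //; exact: h2.
Qed.

(** * A source bounded away from zero is incompatible with a bounded profile *)

Section decay.
Variable R : realType.

Lemma decrease_at_least (f df : R -> R) (S k : R) :
  (forall s, S <= s -> is_derive s 1 f (df s)) ->
  (forall s, S <= s -> df s <= - k) ->
  forall t, S <= t -> f t <= f S - k * (t - S).
Proof.
move=> fd dfk t St.
have [||c] := @MVT_segment R f df S t St.
- by move=> x; rewrite in_itv /= => /andP[/ltW Sx _]; exact: fd.
- apply: derivable_within_continuous => x; rewrite in_itv /= => /andP[Sx _].
  by have [] := fd x Sx.
rewrite in_itv /= => /andP[Sc _] e.
by have := ler_wpM2r (_ : 0 <= t - S) (dfk c Sc); rewrite subr_ge0 => /(_ St); lra.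
Qed.

(* [s g + (n - 2) p] has derivative [- b / 2], so it tends to [-oo] when the
   source [b] stays away from [0]; as [p] is bounded this forces [g], hence
   [p] itself, down to [-oo]. *)
Lemma source_not_bounded_below (n : nat) (p g b : R -> R) (S e : R) :
  0 < S -> 0 < e ->
  (forall s : R, 0 < s -> is_derive s 1 p (g s / 2)) ->
  (forall s : R, 0 < s -> is_derive s 1 g (- (b s + n%:R * g s) / (2 * s))) ->
  (forall s, S <= s -> 0 <= p s <= 1) ->
  (forall s, S <= s -> e <= b s) -> False.
Proof.
move=> S0 e0 pd gd p01 be.
pose q s := s * g s + (n%:R - 2) * p s.
have qd s : S <= s -> is_derive s 1 q (- b s / 2).
  move=> Ss; have s0 : 0 < s by apply: lt_le_trans Ss.
  have hp := pd s s0; have hg := gd s s0.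
  have -> : q = id * g + ((n%:R - 2) \*: p) by apply/funext => x; rewrite /q !fctE.
  apply: is_derive_eq; rewrite /GRing.scale /=; field.
  by rewrite gt_eqF.
have hq := @decrease_at_least q _ S (e / 2) qd.
have {}hq t : S <= t -> q t <= q S - e / 2 * (t - S).
  by apply: hq => s Ss; have := be s Ss; lra.
pose K := `|q S| + n%:R + 2.
have gK t : S <= t -> t * g t <= K + e / 2 * S - e / 2 * t.
  move=> St; have := hq t St; have := p01 t St; rewrite /q /K.
  have nn : 0 <= n%:R :> R by [].
  have := ler_norm (q S); rewrite /q; nra.
pose S1 := S + 4 * (K + e / 2 * S) / e.
have K0 : 0 <= K + e / 2 * S.
  have : 0 <= K by rewrite /K !addr_ge0.
  by have := mulr_ge0 (ltW e0) (ltW S0); lra.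
have SS1 : S <= S1 by rewrite /S1 lerDl divr_ge0 ?mulr_ge0 // ltW.
have g1 t : S1 <= t -> g t / 2 <= - (e / 8).
  move=> S1t; have St := le_trans SS1 S1t; have t0 : 0 < t by apply: lt_le_trans St.
  have h : 4 * (K + e / 2 * S) / e <= t by move: S1t; rewrite /S1; lra.
  rewrite ler_pdivrMr // in h.
  have : t * g t <= t * (- (e / 4)) by have := gK t St; lra.
  by rewrite ler_pM2l //; lra.
have S10 : 0 < S1 by apply: lt_le_trans SS1.
have pd1 s : S1 <= s -> is_derive s 1 p (g s / 2).
  by move=> h; apply: pd; exact: lt_le_trans h.
have hp := decrease_at_least pd1 g1.
pose t := S1 + 16 / e.
have tS1 : S1 <= t by rewrite /t lerDl divr_ge0 // ltW.
have := hp t tS1; have /andP[h1 _] := p01 t (le_trans SS1 tS1).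
have /andP[_ h2] := p01 S1 SS1.
have -> : e / 8 * (t - S1) = 2 by rewrite /t; field; rewrite gt_eqF.
by lra.
Qed.
End decay.

Lemma is_derive_near_cst {R : realType} (f : R -> R) (s c d : R) :
  is_derive s 1 f d -> (\forall t \near s, f t = c) -> d = 0.
Proof.
move=> fd fc; have h := near_eq_is_derive fc fd.
by have [_ <-] := h; have [_ ->] := is_derive_cst c s (1 : R).
Qed.

Lemma enorm_sqn {R : realType} {n : nat} (x : 'rV[R]_n) : enorm x = Num.sqrt (sqn x).
Proof. by []. Qed.

Lemma continuous_near_gt {R : realType} {T : topologicalType} (f : T -> R) (x : T) (k : R) :
  {for x, continuous f} -> k < f x -> \forall y \near x, k < f y.
Proof. by move=> fx; exact: (cvgr_gt (f x) fx). Qed.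

Lemma continuous_near_lt {R : realType} {T : topologicalType} (f : T -> R) (x : T) (k : R) :
  {for x, continuous f} -> f x < k -> \forall y \near x, f y < k.
Proof. by move=> fx; exact: (cvgr_lt (f x) fx). Qed.

(** * From the profile to solutions of the system *)

Section solution.
Variables (R : realType) (n L : nat) (F : 'rV[R]_L -> 'rV[R]_L).
Hypotheses (n0 : (0 < n)%N) (L0 : (0 < L)%N).
Hypothesis F_range : forall u, orthant L u -> orthant L (F u).
Hypothesis F_nondeg : nondegenerate_map F.

Local Notation B := (fun u => F (clip u)).

Hypothesis B_cont : continuous B.

Variables (P G : R -> 'rV[R]_L) (M : R).
Hypothesis P0 : simplex L (P 0).
Hypothesis P_lip : forall (s t : R) c, s <= t ->
  P s ord0 c - (t - s) * M <= P t ord0 c <= P s ord0 c.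
Hypothesis G_cont : forall c, G 0 ord0 c = - B (P 0) ord0 c / n%:R /\
  forall s : R, 0 <= s -> {for s, continuous (fun t => G t ord0 c)}.
Hypothesis PG_der : forall (s : R) c, 0 < s ->
  is_derive s 1 (fun t => P t ord0 c) (G s ord0 c / 2) /\
  is_derive s 1 (fun t => G t ord0 c) (drift n B (P s) (G s) s c).

Let P_nincr s t c : s <= t -> P t ord0 c <= P s ord0 c.
Proof. by move=> /(P_lip c)/andP[]. Qed.

Let P_le1 s c : 0 <= s -> P s ord0 c <= 1.
Proof. by move=> s0; apply: le_trans (P_nincr c s0) (simplex_le1 c P0). Qed.

Let coord_cont c s : {for s, continuous (fun t => P t ord0 c)}.
Proof. by apply: (p_cont (M := M)) => a b; exact: P_lip. Qed.

Let P_cont : continuous P.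
Proof. by move=> s; apply: cvg_row => c; exact: coord_cont. Qed.

Let BP_cont c s : {for s, continuous (fun t => B (P t) ord0 c)}.
Proof.
move: s; apply: continuous_coord => s.
by apply: (@cvg_comp _ _ _ P B _ _ _ (@P_cont s)); exact: B_cont.
Qed.

Let BPE s : 0 <= s -> (forall c, 0 <= P s ord0 c) -> B (P s) = F (P s).
Proof. by move=> s0 h; rewrite /= clip_id // => i; rewrite h P_le1. Qed.

Let u (x : 'rV[R]_n) := P (sqn x).

Let u_C2 c (V : set 'rV[R]_n) : C_k 2 V (fun x => u x ord0 c).
Proof.
have [g0 gc] := G_cont c.
apply: (radial_C2 (p := fun t => P t ord0 c) (g := fun t => G t ord0 c)
  (b := fun t => B (P t) ord0 c) (M := M) n0) => //.
- by move=> s t; exact: P_lip.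
- by move=> s s0; have [] := PG_der c s0.
- by move=> s s0; have [] := PG_der c s0.
Qed.

Let u_laplacian c x : - laplacian (fun y => u y ord0 c) x = B (u x) ord0 c.
Proof.
have [g0 gc] := G_cont c.
apply: (radial_laplacian (p := fun t => P t ord0 c) (g := fun t => G t ord0 c)
  (b := fun t => B (P t) ord0 c) (M := M) n0) => //.
- by move=> s t; exact: P_lip.
- by move=> s s0; have [] := PG_der c s0.
- by move=> s s0; have [] := PG_der c s0.
Qed.

Lemma positive_solution_radial (V : set 'rV[R]_n) :
  (forall x, V x -> pos_vec (u x)) -> positive_solution F V u.
Proof.
move=> up; split=> [c|]; first exact: u_C2.
split=> // x Vx c; rewrite u_laplacian BPE ?sqn_ge0 // => i.
by apply: ltW; exact: up.
Qed.

(* A component that vanishes at [s] stays zero afterwards, so its source is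
   zero there; nondegeneracy forbids this while another one is positive. *)
Lemma vanishing_together (s eta : R) c : 0 <= s -> 0 < eta ->
  (forall t i, t < s + eta -> 0 <= P t ord0 i) -> P s ord0 c = 0 -> P s = 0.
Proof.
move=> s0 eta0 Ppos Psc; apply: contrapT => Ps0.
have Ps i : 0 <= P s ord0 i by apply: Ppos; rewrite ltrDl.
have [a Pa] : exists a, 0 < P s ord0 a.
  apply: contrapT => no; apply: Ps0; apply/rowP => a; rewrite mxE.
  apply/eqP; rewrite eq_le Ps andbT leNgt; apply/negP => h.
  by apply: no; exists a.
have [i Psi Fsi] := nondegenerate_source F_nondeg Ps (ex_intro _ c Psc) (ex_intro _ a Pa).
have zero t : s <= t -> t < s + eta -> P t ord0 i = 0.
  move=> st te; apply/eqP; rewrite eq_le Ppos // andbT -Psi.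
  exact: P_nincr.
have near_in t : s < t < s + eta -> \forall r \near t, s < r < s + eta.
  move=> /andP[st te]; near=> r; apply/andP; split; near: r.
    exact: (cvgr_gt t (@cvg_id _ (nbhs t))).
  exact: (cvgr_lt t (@cvg_id _ (nbhs t))).
have Gzero t : s < t < s + eta -> G t ord0 i = 0.
  move=> ht; have /andP[st te] := ht.
  have [h _] := PG_der i (le_lt_trans s0 st).
  have : \forall r \near t, P r ord0 i = 0.
    by apply: filterS (near_in t ht) => r /andP[/ltW sr re]; exact: zero.
  by move=> /(is_derive_near_cst h); lra.
have Bzero t : s < t < s + eta -> B (P t) ord0 i = 0.
  move=> ht; have /andP[st te] := ht; have t0 := le_lt_trans s0 st.
  have [_ h] := PG_der i t0.
  have : \forall r \near t, G r ord0 i = 0.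
    by apply: filterS (near_in t ht) => r; exact: Gzero.
  move=> /(is_derive_near_cst h); rewrite /drift Gzero // mulr0 addr0.
  move=> /eqP; rewrite mulf_eq0 oppr_eq0 invr_eq0 mulf_eq0 pnatr_eq0 /= (gt_eqF t0) orbF.
  by move/eqP.
rewrite -(BPE s0 Ps) in Fsi.
have /nbhs_ballP[d d0 hd] : \forall t \near s, 0 < B (P t) ord0 i.
  exact: (continuous_near_gt (@BP_cont i s) Fsi).
(* At time [s + e] the source of component [i] is zero by [Bzero] and positive by [hd]. *)
pose e := Num.min d eta / 2.
have e0 : 0 < e by rewrite divr_gt0 // lt_min d0.
have m0 : 0 < Num.min d eta by rewrite lt_min d0.
have md : Num.min d eta <= d by rewrite ge_min lexx.
have me : Num.min d eta <= eta by rewrite ge_min lexx orbT.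
have ed : e < d by rewrite /e; lra.
have ee : e < eta by rewrite /e; lra.
have := hd (s + e); rewrite Bzero ?ltrDl ?e0 ?ltrD2l // ltxx.
rewrite /ball /= opprD addrA subrr add0r normrN gtr0_norm // => /(_ ed).
by [].
Unshelve. all: by end_near. Qed.

Lemma positive_before (T : R) : 0 <= T -> (forall s, 0 <= s < T -> P s <> 0) ->
  (forall s c, s <= T -> 0 <= P s ord0 c) -> forall s, 0 <= s < T -> pos_vec (P s).
Proof.
move=> T0 nz Ppos s /[dup] hs /andP[s0 sT] c.
rewrite lt_def Ppos ?ltW // andbT; apply/eqP => e.
apply: (nz s hs); apply: (vanishing_together (eta := T - s) (c := c)) => //.
  by rewrite subr_gt0.
by move=> t i; rewrite addrC subrK => /ltW; exact: Ppos.
Qed.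

(** The first zero [T] is positive because [P 0] lies in the simplex, and monotonicity gives
    nonnegativity up to [T]. As time is [|x|^2], the radius is the square root of [T]. *)
Lemma dirichlet_of_zero : (exists2 T, 0 <= T & P T = 0) ->
  exists2 r : R, 0 < r & dirichlet_solution F r u.
Proof.
move=> [T1 T10 PT1]; pose Z := [set T | 0 <= T /\ P T = 0]; pose T := inf Z.
have Zlb : has_lbound Z by exists 0 => t [].
have Z0 : Z !=set0 by exists T1.
have T0 : 0 <= T by apply: lb_le_inf => // t [].
have nz s : 0 <= s < T -> P s <> 0.
  move=> /andP[s0 sT] Ps; move: sT; rewrite ltNge => /negP; apply.
  by apply: ge_inf.
(* The infimum is attained: a positive component would stay positive just after [T], and a component
   at [T] is at least its value [0] at a later zero. *)
have PT : P T = 0.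
  apply/rowP => c; rewrite mxE; apply/eqP; rewrite eq_le; apply/andP; split.
    rewrite leNgt; apply/negP => h.
    have /nbhs_ballP[d d0 hd] : \forall t \near T, 0 < P t ord0 c.
      exact: (continuous_near_gt (@coord_cont c T) h).
    have [t [t0 Pt] tT] := inf_adherent d0 (conj Z0 Zlb).
    have Tt : T <= t by exact: ge_inf.
    have := hd t; rewrite Pt mxE ltxx /ball /= distrC ger0_norm ?subr_ge0 //.
    by rewrite ltrBlDl => /(_ tT).
  have [t [t0 Pt] tT] := inf_adherent ltr01 (conj Z0 Zlb).
  have Tt : T <= t by exact: ge_inf.
  by have := P_nincr c Tt; rewrite Pt mxE.
have Tpos : 0 < T.
  rewrite lt_def T0 andbT; apply/eqP => e; move: PT; rewrite e => P00.
  have [_] := P0; rewrite big1 => [/eqP|i _]; first by rewrite eq_sym oner_eq0.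
  by rewrite P00 mxE.
have Ppos s c : s <= T -> 0 <= P s ord0 c.
  by move=> /(P_nincr c); rewrite PT mxE.
have up := positive_before T0 nz Ppos.
have ballE x : eball n (Num.sqrt T) x <-> sqn x < T.
  by rewrite /eball /= enorm_sqn ltr_sqrt.
have uc : continuous u.
  by move=> x; apply: (@cvg_comp _ _ _ _ P _ _ _ (@sqn_continuous R n x) (@P_cont _)).
exists (Num.sqrt T); first by rewrite sqrtr_gt0.
split; first by apply: positive_solution_radial => x /ballE h; apply: up; rewrite sqn_ge0.
split; first exact: continuous_subspaceT.
move=> x [xc xi]; suff -> : u x = P T by [].
congr P; apply/eqP; rewrite eq_le; apply/andP; split.
  have cl : closed [set y : 'rV[R]_n | sqn y <= T].
    by apply: (preimage_closed _ (@closed_le R T)) => y _; exact: sqn_continuous.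
  have : closure (eball n (Num.sqrt T)) `<=` [set y : 'rV[R]_n | sqn y <= T].
    move/closure_id : cl => ->; apply: closureS => y /ballE; exact: ltW.
  exact.
rewrite leNgt; apply/negP => h; apply: xi.
apply: (@filterS _ (nbhs x) _ [set y | sqn y < T]); first by move=> y /ballE.
exact: (continuous_near_lt (@sqn_continuous R n x) h).
Qed.

Section entire.
Hypothesis P_ge0 : forall s c, 0 <= P s ord0 c.
Hypothesis P_nz : forall s, 0 <= s -> P s <> 0.

Lemma positive_entire s : 0 <= s -> pos_vec (P s).
Proof.
move=> s0; have s10 : 0 <= s + 1 by rewrite addr_ge0.
apply: (positive_before s10) => //; first by move=> t /andP[t0 _]; exact: P_nz.
by rewrite s0 ltrDl ltr01.
Qed.

Lemma vanishes_radial :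
  (forall v : 'rV[R]_L, orthant L v -> pos_vec v -> F v <> 0) ->
  vanishes_at_infinity u.
Proof.
move=> Fnz; pose Z c := [set P s ord0 c | s in [set s : R | 0 <= s]].
pose l : 'rV[R]_L := \row_c inf (Z c).
have Zlb c : has_lbound (Z c) by exists 0 => _ [t _ <-].
have Z0 c : Z c !=set0 by exists (P 0 ord0 c), 0 => /=.
have l0 c : 0 <= l ord0 c by rewrite mxE; apply: lb_le_inf => // _ [t _ <-].
have lP s c : 0 <= s -> l ord0 c <= P s ord0 c.
  by move=> s0; rewrite mxE; apply: ge_inf => //; exists s.
have lim d : 0 < d -> exists2 S : R, 0 < S & forall s c, S <= s -> P s ord0 c < l ord0 c + d.
  move=> d0; have /choice[N hN] : forall c, exists s, 0 <= s /\ P s ord0 c < l ord0 c + d.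
    move=> c; have [_ [s s0 <-] hs] := inf_adherent d0 (conj (Z0 c) (Zlb c)).
    by exists s; rewrite mxE.
  have N0 c : 0 <= N c by have [] := hN c.
  (* The sum bounds all the nonnegative times [N c]; adding [1] makes it positive. *)
  exists (\sum_c N c + 1) => [|s c hs]; first by rewrite ltr_wpDl // sumr_ge0.
  have [_] := hN c; apply: le_lt_trans; apply: P_nincr; apply: le_trans hs.
  by rewrite (bigD1 c) //= -addrA lerDl addr_ge0 // sumr_ge0.
have l1 c : l ord0 c <= 1 by apply: le_trans (lP 0 c (lexx 0)) (P_le1 c (lexx 0)).
have l_eq0 : l = 0.
  apply: contrapT => lnz.
  have [a la] : exists a, 0 < l ord0 a.
    apply: contrapT => no; apply: lnz; apply/rowP => a; rewrite [RHS]mxE.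
    apply/eqP; rewrite eq_le l0 andbT leNgt; apply/negP => h.
    by apply: no; exists a.
  (* If [l] has a zero component nondegeneracy applies, otherwise the nonvanishing hypothesis does.
     By continuity this source then stays above half its value near [l], where the profile
     eventually remains. *)
  have [i Fi] : exists i, 0 < F l ord0 i.
    have [[c lc]|nozero] := pselect (exists c, l ord0 c = 0).
      by have [i _ Fi] := nondegenerate_source F_nondeg l0 (ex_intro _ c lc)
        (ex_intro _ a la); exists i.
    apply: contrapT => no; apply: (Fnz l) => //.
      move=> c; rewrite lt_def l0 andbT; apply/eqP => e; apply: nozero.
      by exists c.
    apply/rowP => i; rewrite mxE; apply/eqP; rewrite eq_le F_range // andbT leNgt.
    by apply/negP => h; apply: no; exists i.
  have Bi : F l ord0 i / 2 < B l ord0 i.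
    rewrite /= clip_id; first by lra.
    by move=> c; rewrite l0 l1.
  have [d d0 hd] : exists2 d : R, 0 < d & forall v : 'rV[R]_L,
      (forall c, `|l ord0 c - v ord0 c| < d) -> F l ord0 i / 2 < B v ord0 i.
    by apply: near_row; exact: (continuous_near_gt (@continuous_coord R _ L B i B_cont l) Bi).
  have [S S0 hS] := lim d d0.
  apply: (@source_not_bounded_below R n (fun t => P t ord0 i) (fun t => G t ord0 i)
     (fun t => B (P t) ord0 i) S (F l ord0 i / 2)) => //.
  - by rewrite divr_gt0.
  - by move=> s s0; have [] := PG_der i s0.
  - by move=> s s0; have [] := PG_der i s0.
  - by move=> s Ss; rewrite P_ge0 P_le1 // ltW // (lt_le_trans S0).
  - move=> s Ss; apply/ltW/hd => c; have := hS s c Ss.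
    have := lP s c (ltW (lt_le_trans S0 Ss)).
    by rewrite ltr_norml; lra.
move=> e e0; have [S S0 hS] := lim e e0; exists (S + 1) => x hx.
apply: row_norm_lt => // c; rewrite ger0_norm; last exact: P_ge0.
have := hS (sqn x) c; rewrite l_eq0 mxE add0r; apply.
have S1 : S + 1 < Num.sqrt (sqn x) by [].
rewrite -(sqr_sqrtr (sqn_ge0 x)); move: S1; move: (Num.sqrt _) => y; nra.
Qed.
End entire.
End solution.

(* [F] is a total function whose values off the orthant are irrelevant: every
   hypothesis and conclusion only involves its values on [orthant L].
   [F_lip] unfolds to a Lipschitz bound on [F v - F w] for [(v, w)] near each
   pair of interior points; taken at the diagonal pairs it is the usual local
   Lipschitz condition, and off the diagonal it already follows from it. *)
Theorem theorem1 (R : realType) (n L : nat) (hn : (1 <= n)%N) (hL : (1 <= L)%N)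
    (F : 'rV[R]_L -> 'rV[R]_L)
    (F_range : forall u, orthant L u -> orthant L (F u))
    (F_cont : {within orthant L, continuous F})
    (F_lip : [locally [lipschitz F u | u in (orthant L)°]])
    (F_nondeg : nondegenerate_map F)
    (no_dirichlet : forall r : R, 0 < r ->
       ~ exists u : 'rV[R]_n -> 'rV[R]_L, dirichlet_solution F r u) :
  (exists u : 'rV[R]_n -> 'rV[R]_L, positive_solution F setT u) /\
  ((forall u : 'rV[R]_L, orthant L u -> pos_vec u -> F u <> 0) ->
   exists u : 'rV[R]_n -> 'rV[R]_L,
     positive_solution F setT u /\ vanishes_at_infinity u).
Proof.
have B_cont := clipped_continuous F_cont.
have [M B0M] := clipped_bounded F_range F_cont.
have [P [G [P0 P_lip G_cont PG_der P_exit]]] := radial_profile hn hL B0M B_cont.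
have P_nz s : 0 <= s -> P s <> 0.
  move=> s0 Ps; have [|r r0 ur] := dirichlet_of_zero hn F_nondeg B_cont P0 P_lip G_cont PG_der.
    by exists s.
  by apply: (no_dirichlet r r0); eexists; exact: ur.
(* Excluding zeros of [P] leaves only the global alternative of [radial_profile]. *)
have P_ge0 s c : 0 <= P s ord0 c by case: P_exit => [//|[T /P_nz]].
have Ppos := positive_entire F_nondeg B_cont P0 P_lip PG_der P_ge0 P_nz.
have usol : positive_solution F setT (fun x : 'rV[R]_n => P (sqn x)).
  apply: (positive_solution_radial hn B_cont P0 P_lip G_cont PG_der) => x _.
  by apply: Ppos; exact: sqn_ge0.
split; first by eexists; exact: usol.
move=> Fnz; eexists; split; first exact: usol.
exact: (vanishes_radial F_range F_nondeg B_cont P0 P_lip PG_der P_ge0).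
Qed.
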